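(* Let $n\ge1$ and let $K:\mathbb{R}^n\to[0,\infty)$ be measurable with $K(\zeta)=K(-\zeta)$ for a.e. $\zeta\in\mathbb{R}^n$. Suppose that there are $m_0,r_0,R_0>0$ such that $K\ge m_0\,\chi_{B_{r_0}}$ in $\mathbb{R}^n$, $K\equiv0$ in $\mathbb{R}^n\setminus B_{R_0}$, and $\int_{B_{R_0}}|\zeta|^2K(\zeta)\,d\zeta<\infty$. Let $\mathcal{L}$ be the operator with kernel $K$, let $f\in C^1(\mathbb{R})$, and let $u$ be a bounded solution of $\mathcal{L}u=f(u)$ in $\mathbb{R}^n$. If there exists a continuous function $\varphi>0$ on $\mathbb{R}^n$ solving $$\mathcal{L}\varphi=f'(u)\varphi\quad\text{in }\mathbb{R}^n,$$ then $$\frac12\int_{\mathbb{R}^n}\int_{\mathbb{R}^n}\big(\xi(x)-\xi(x+y)\big)^2K(y)\,dy\,dx\ \ge\ \int_{\mathbb{R}^n}f'(u)\,\xi^2\,dx\qquad\text{for every }\xi\in C_c^\infty(\mathbb{R}^n).$$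
   Context: $B_r$ is the open Euclidean ball of radius $r$ centered at the origin, $B_r(x)=x+B_r$, and $\chi_E$ is the characteristic function of $E$. The operator with kernel $K$ is $$\mathcal{L}u(x)=\int_{\mathbb{R}^n}\big(u(x)-u(y)\big)K(x-y)\,dy,$$ understood, when $K$ is not integrable, in the principal value sense $\lim_{r\to0}\int_{\mathbb{R}^n\setminus B_r(x)}\big(u(x)-u(y)\big)K(x-y)\,dy$. That $u$ (measurable) is a solution of $\mathcal{L}u=f(u)$ in $\mathbb{R}^n$ means that $\mathcal{L}u(x)$ exists and equals $f(u(x))$ for every $x\in\mathbb{R}^n$. The linearized equation $\mathcal{L}\varphi=f'(u)\varphi$ for continuous $\varphi$ is understood in the weak sense: $\int_{\mathbb{R}^n}\varphi\,\mathcal{L}\xi\,dx=\int_{\mathbb{R}^n}f'(u)\,\varphi\,\xi\,dx$ for all $\xi\in C_c^\infty(\mathbb{R}^n)$. *)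

(* Defs.v *)
From HB Require Import structures.
From mathcomp Require Import all_boot all_order all_algebra.
From mathcomp Require Import all_classical all_reals all_analysis.

Set Implicit Arguments.
Unset Strict Implicit.
Unset Printing Implicit Defensive.

Import Order.TTheory GRing.Theory Num.Theory.
Import numFieldNormedType.Exports.

Local Open Scope classical_set_scope.
Local Open Scope ring_scope.

Definition measure_rV_display : measure_display.
Proof. exact: default_measure_display. Qed.

(* The Borel sets of R^n, as the sigma-algebra generated by the coordinates
   (the library does the same for n.-tuple). *)
Section measurable_rV.
Context {R : realType} (n : nat).

Let coor (i : 'I_n) (x : 'rV[R]_n) : R := x 0 i.

Let rV_set0 : g_sigma_preimage coor set0.
Proof. exact: sigma_algebra0. Qed.

Let rV_setC A : g_sigma_preimage coor A -> g_sigma_preimage coor (~` A).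
Proof. exact: sigma_algebraC. Qed.

Let rV_bigcup (F : _^nat) : (forall i, g_sigma_preimage coor (F i)) ->
  g_sigma_preimage coor (\bigcup_i (F i)).
Proof. exact: sigma_algebra_bigcup. Qed.

HB.instance Definition _ := @isMeasurable.Build measure_rV_display
  'rV[R]_n (g_sigma_preimage coor) rV_set0 rV_setC rV_bigcup.

End measurable_rV.

Section measurable_rV_lemmas.
Context {R : realType}.

Lemma measurable_rV_coor n (i : 'I_n) :
  measurable_fun [set: 'rV[R]_n] (fun x : 'rV[R]_n => x 0 i).
Proof.
move=> _ Y mY; rewrite setTI; apply: sub_sigma_algebra => /=.
rewrite -bigcup_seq/=; exists i => /=; first by rewrite mem_index_enum.
by exists Y => //; rewrite setTI.
Qed.

Lemma measurable_fun_rV d (T : measurableType d) n (f : T -> 'rV[R]_n) :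
  (forall i, measurable_fun [set: T] (fun t => f t 0 i)) ->
  measurable_fun [set: T] f.
Proof.
move=> mf.
pose coor (i : 'I_n) (x : 'rV[R]_n) : R := x 0 i.
suff: g_sigma_preimage (fun i => coor i \o f) `<=` measurable.
  rewrite g_sigma_preimage_comp => prefS.
  by move=> _ A mA; apply: prefS; exists A.
apply: smallest_sub; first exact: sigma_algebra_measurable.
case: n => [|n] in f mf coor *; first by rewrite big_ord0.
rewrite -bigcup_mkord_ord; apply: bigcup_sub => i Ii.
by move=> A [B mB <-]; exact: mf.
Qed.

End measurable_rV_lemmas.

(* The n-fold product of the one-dimensional Lebesgue measure, on Borel sets;
   consR identifies R * R^n with R^(1 + n). *)
Section borel_lebesgue.
Context {R : realType}.

Definition consR n (p : measurableTypeR R * 'rV[R]_n) : 'rV[R]_n.+1 :=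
  row_mx (p.1 : R)%:M p.2.

Lemma consR0 n (p : measurableTypeR R * 'rV[R]_n) : consR p 0 ord0 = p.1.
Proof.
rewrite (_ : ord0 = lshift n (0 : 'I_1)); last exact/val_inj.
by rewrite (@row_mxEl R 1 1 n) mxE eqxx mulr1n.
Qed.

Lemma consRS n (p : measurableTypeR R * 'rV[R]_n) i :
  consR p 0 (lift ord0 i) = p.2 0 i.
Proof.
rewrite (_ : lift ord0 i = rshift 1 i); last exact/val_inj.
exact: (@row_mxEr R 1 1 n).
Qed.

Lemma measurable_consR n : measurable_fun [set: _] (@consR n).
Proof.
apply: measurable_fun_rV => i; have [j ->|->] := unliftP ord0 i.
- under eq_fun do rewrite consRS.
  exact: (measurableT_comp (measurable_rV_coor j)).
- under eq_fun do rewrite consR0.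
  exact: measurable_fst.
Qed.

Definition unconsR n (x : 'rV[R]_n.+1) : measurableTypeR R * 'rV[R]_n :=
  (x 0 0, rsubmx (x : 'rV_(1 + n))).

Lemma measurable_unconsR n : measurable_fun [set: _] (@unconsR n).
Proof.
apply/measurable_fun_pairP; split; first exact: measurable_rV_coor.
apply: measurable_fun_rV => i.
rewrite [X in measurable_fun _ X](_ : _ =
  fun x : 'rV[R]_n.+1 => x 0 (rshift 1 i)); last first.
  by apply/funext => x; rewrite /= mxE.
exact: (@measurable_rV_coor R n.+1 (rshift 1 i)).
Qed.

Lemma consRK n : cancel (@consR n) (@unconsR n).
Proof.
move=> [t x]; rewrite /unconsR; congr pair; first exact: consR0.
exact: (@row_mxKr R 1 1 n).
Qed.

Section step.
Context (n : nat) (mu : {sigma_finite_measure set 'rV[R]_n -> \bar R}).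

Definition borel_lebesgueS : set 'rV[R]_n.+1 -> \bar R :=
  pushforward (lebesgue_measure \x mu)%E (@consR n).

Let step0 : borel_lebesgueS set0 = 0%E.
Proof. by have mcons := @measurable_consR n; apply: measure0. Qed.

Let step_ge0 A : (0 <= borel_lebesgueS A)%E.
Proof. by have mcons := @measurable_consR n; apply: measure_ge0. Qed.

Let step_sigma_additive : semi_sigma_additive borel_lebesgueS.
Proof. by have mcons := @measurable_consR n; apply: measure_semi_sigma_additive. Qed.

HB.instance Definition _ := isMeasure.Build _ _ _ borel_lebesgueS
  step0 step_ge0 step_sigma_additive.

Let step_sigma_finite : sigma_finite setT borel_lebesgueS.
Proof.
have /sigma_finiteP[F [TF ndF Foo]] := sigma_finiteT (@lebesgue_measure R).
have /sigma_finiteP[G [TG ndG Goo]] := sigma_finiteT mu.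
exists (fun k => @unconsR n @^-1` (F k `*` G k)).
  rewrite -preimage_bigcup (_ : \bigcup_k _ = setT) ?preimage_setT//.
  rewrite -setXTT TF TG predeqE => -[x y]; split.
    by move=> [k _ [/= ? ?]]; split; exists k.
  move=> [/= [k _ Fkx] [l _ Gly]]; exists (maxn k l) => //; split.
  - by move: x Fkx; exact/subsetPset/ndF/leq_maxl.
  - by move: y Gly; exact/subsetPset/ndG/leq_maxr.
move=> k; have [mF Fk] := Foo k; have [mG Gk] := Goo k; split.
  rewrite -[X in measurable X]setTI; apply: measurable_unconsR => //.
  exact: measurableX.
rewrite /borel_lebesgueS /pushforward -comp_preimage.
rewrite (_ : _ \o _ = id); last by apply/funext => p /=; rewrite consRK.
by rewrite preimage_id product_measure1E// lte_mul_pinfty// ge0_fin_numE.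
Qed.

HB.instance Definition _ :=
  Measure_isSigmaFinite.Build _ _ _ borel_lebesgueS step_sigma_finite.

End step.

Fixpoint borel_lebesgue n : {sigma_finite_measure set 'rV[R]_n -> \bar R} :=
  match n with
  | 0 => dirac (0 : 'rV[R]_0)
  | n'.+1 => borel_lebesgueS (borel_lebesgue n')
  end.

Lemma borel_lebesgue_box n (A : 'I_n -> set (measurableTypeR R)) :
  (forall i, measurable (A i)) ->
  borel_lebesgue n [set x | forall i, A i (x 0 i)] =
  (\prod_(i < n) lebesgue_measure (A i))%E.
Proof.
elim: n A => [|n IHn] A mA /=.
  by rewrite big_ord0 diracE mem_set//= => -[].
rewrite big_ord_recl -IHn; last by move=> i; exact: mA.
pose B : set 'rV[R]_n := [set x | forall i, A (lift ord0 i) (x 0 i)].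
have mB : measurable B.
  rewrite (_ : B = \big[setI/setT]_(i < n)
      ((fun x : 'rV[R]_n => x 0 i) @^-1` A (lift ord0 i))).
    apply: bigsetI_measurable => i _; rewrite -[X in measurable X]setTI.
    by apply: measurable_rV_coor => //; exact: mA.
  apply/seteqP; split => x /=; rewrite -bigcap_seq /= => Bx i.
    by move=> _; exact: Bx.
  by apply: Bx; rewrite /= mem_index_enum.
rewrite -[RHS](product_measure1E lebesgue_measure (borel_lebesgue n))//.
rewrite /borel_lebesgueS /pushforward; congr product_measure1.
apply/seteqP; split => -[t x] /= Ap.
  split=> [|i]; first by have := Ap ord0; rewrite consR0.
  by have := Ap (lift ord0 i); rewrite consRS.
move=> i; have [j ->|->] := unliftP ord0 i; last by rewrite consR0; case: Ap.
by rewrite consRS; case: Ap.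
Qed.

End borel_lebesgue.

(* Lebesgue measure on R^n and the Lebesgue measurable sets: lebesgue_rV R n is
   'rV[R]_n equipped with the completion of the Borel sigma-algebra. *)
Section lebesgue_vol.
Context (R : realType) (n : nat).

Definition lebesgue_rV := caratheodory_type
  ((@borel_lebesgue R n : set 'rV[R]_n -> \bar R)^*)%mu.

HB.instance Definition _ := Measurable.on lebesgue_rV.

Definition lebesgue_vol : set lebesgue_rV -> \bar R :=
  @completed_measure_extension _ 'rV[R]_n R (borel_lebesgue n).

HB.instance Definition _ := Measure.on lebesgue_vol.

Let lebesgue_vol_sigma_finite : sigma_finite setT lebesgue_vol.
Proof. exact/completed_measure_extension_sigma_finite/sigma_finiteT. Qed.

HB.instance Definition _ :=
  Measure_isSigmaFinite.Build _ _ _ lebesgue_vol lebesgue_vol_sigma_finite.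

End lebesgue_vol.
Arguments lebesgue_vol {R n}.

Section nonlocal_operator.
Context {R : realType} {n : nat}.
Implicit Types (K u xi phi : 'rV[R]_n -> R) (x y : 'rV[R]_n) (r : R).

(* The norm `|x| of the library is the sup norm. *)
Definition enorm x : R := Num.sqrt (\sum_(i < n) x 0 i ^+ 2).

Definition eball x r : set 'rV[R]_n := [set y | enorm (y - x) < r].

Definition lebesgue_measurable u :=
  measurable_fun [set: lebesgue_rV R n] (u : lebesgue_rV R n -> R).

Definition lebesgue_integrable (D : set 'rV[R]_n) u : bool :=
  lebesgue_vol.-integrable (D : set (lebesgue_rV R n)) (EFin \o u).

Definition integrand K u x y : R := (u x - u y) * K (x - y).

Definition truncated_op K u x r : R :=
  \int[lebesgue_vol]_(y in ~` eball x r) integrand K u x y.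

(* L u (x). When K is integrable the integral is taken over the whole space;
   otherwise it is a principal value. Junk unless nonlocal_op_exists K u x. *)
Definition nonlocal_op K u x : R :=
  if lebesgue_integrable setT K then \int[lebesgue_vol]_y integrand K u x y
  else lim (truncated_op K u x r @[r --> 0^'+]).

Definition nonlocal_op_exists K u x : Prop :=
  if lebesgue_integrable setT K then
    lebesgue_integrable setT (integrand K u x) : Prop
  else
    (forall r, 0 < r -> lebesgue_integrable (~` eball x r) (integrand K u x)) /\
    cvg (truncated_op K u x r @[r --> 0^'+]).

Definition solution K (f : R -> R) u : Prop :=
  lebesgue_measurable u /\
  forall x, nonlocal_op_exists K u x /\ nonlocal_op K u x = f (u x).

Definition iter_partial (s : seq 'I_n) u : 'rV[R]_n -> R :=
  foldr (fun i v => 'D_(delta_mx 0 i) v) u s.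

Definition smooth u : Prop := forall s : seq 'I_n,
  continuous (iter_partial s u) /\
  forall (i : 'I_n) x, derivable (iter_partial s u) x (delta_mx 0 i).

Definition test_function xi : Prop :=
  smooth xi /\ compact (closure [set x | xi x != 0]).

(* phi is a weak solution of L phi = V phi; L xi exists at every point for
   every test function xi and the kernels considered here. *)
Definition weak_solution K (V : 'rV[R]_n -> R) phi : Prop :=
  forall xi, test_function xi ->
    (\int[lebesgue_vol]_x (phi x * nonlocal_op K xi x)%:E =
     \int[lebesgue_vol]_x (V x * phi x * xi x)%:E)%E.

End nonlocal_operator.

(* Main.v *)
Require Import Defs.
From mathcomp Require Import all_boot all_order all_algebra.
From mathcomp Require Import all_classical all_reals all_analysis.
From mathcomp Require Import measurable_realfun ring lra.

Set Implicit Arguments.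
Unset Strict Implicit.
Unset Printing Implicit Defensive.

Import Order.TTheory GRing.Theory Num.Theory.
Import numFieldNormedType.Exports.

Local Open Scope classical_set_scope.
Local Open Scope ring_scope.

(** The operator is bounded below by its potential because a positive solution
    of the linearized equation can be used as a weight. If [phi] were smooth, one
    would test the linearized equation against [xi ^+ 2 / phi]: summation by
    parts turns the left-hand side into half the double integral of
    [(phi z - phi (z + w)) * (xi z ^+ 2 / phi z - xi (z + w) ^+ 2 / phi (z + w))]
    against [K w], and Picone's inequality ([picone]) bounds this integrand by
    [(xi z - xi (z + w)) ^+ 2].

    As [phi] is only continuous and [K] may be singular, the equation is first
    mollified: testing it with [fun x => eta (z - x)] shows that the convolution
    [mollify z] of [phi] and [eta] satisfies, at every point [z], an equation
    with absolutely convergent second differences ([mollified_equation]).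
    Multiplying by [xi z ^+ 2 / mollify z] and integrating in [z] gives the
    inequality [energy_le], in which the potential term is the integral of
    [V * phi * average], where [average] is the convolution of
    [xi ^+ 2 / mollify] with the reflected mollifier. When the support of [eta]
    shrinks, [phi * average] tends pointwise to [xi ^+ 2] by the continuity of
    [phi] and [xi] ([average_close]). The potential [V], which is merely bounded
    and measurable, is left untouched, so dominated convergence concludes
    ([stability]). The average is homogeneous of degree zero in [eta], whence the
    choice of the rescaled squares of [xi] itself as mollifiers.

    Two auxiliary facts carry the analysis. On a test function the operator is
    the integral of second differences against [K / 2] ([nonlocal_opE]), whether
    it was defined as an integral or as a principal value; this rests on the
    invariance of Lebesgue measure under translations and point reflections
    ([integral_isometry]) and on the evenness of [K]. And second differences of a
    test function are quadratically small ([second_diff_le]), which makes every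
    exchange of integrals an instance of Fubini's theorem with a product bound
    ([lebesgue_fubini]). *)

(** * Invariance of Lebesgue measure *)

(** With [c ^+ 2 = 1] the map [fun t => a + c * t] is either a translation or a
    point reflection. *)
Lemma lebesgue_measure_isometry (R : realType) (a c : R) : c ^+ 2 = 1 ->
  forall A : set (measurableTypeR R), measurable A ->
  pushforward lebesgue_measure
    (fun t : measurableTypeR R => a + c * t : measurableTypeR R) A =
  lebesgue_measure A.
Proof.
move=> c2 A mA.
have mf : measurable_fun setT
    (fun t : measurableTypeR R => a + c * t : measurableTypeR R).
  exact: (measurable_funD (measurable_cst _)
           (measurable_funM (measurable_cst _) (@measurable_id _ _ setT))).
apply/esym/lebesgue_measure_unique => // _ [[x y]] _ <- /=.
rewrite /pushforward {mf}.
have /orP[/eqP ->|/eqP ->] : (c == 1) || (c == -1).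
- by rewrite -eqf_sqr c2 expr1n.
- rewrite (_ : _ @^-1` _ = `]x - a, y - a]%classic).
    by rewrite !lebesgue_measure_itv/= !lte_fin ltrD2r -!EFinD opprB addrA addrNK.
  by apply/seteqP; split => t /=; rewrite !in_itv/= mul1r lerBrDl ltrBlDl.
- rewrite (_ : _ @^-1` _ = `[a - y, a - x[%classic).
    rewrite !lebesgue_measure_itv/= !lte_fin ltrD2l ltrN2 -!EFinD.
    by rewrite (_ : a - x - (a - y) = y - x)//; ring.
  apply/seteqP; split => t /=; rewrite !in_itv/= mulN1r => /andP[h1 h2];
  by apply/andP; split; lra.
Qed.

Lemma measurable_isometry (R : realType) d (T : measurableType d) n
    (a : 'rV[R]_n) (c : R) (f : T -> 'rV[R]_n) :
  measurable_fun setT f -> measurable_fun setT (fun x => a + c *: f x).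
Proof.
move=> mf; apply: measurable_fun_rV => i.
rewrite (_ : (fun t => _) = (fun t => a 0 i + c * (f t) 0 i)).
  apply: measurable_funD => //; apply: measurable_funM => //.
  exact: (measurableT_comp (@measurable_rV_coor R n i)).
by apply/funext => t; rewrite !mxE.
Qed.

(** Induction on the dimension: the slice of the preimage over [t] is the preimage
    of a slice over the image of [t]. *)
Lemma borel_lebesgue_isometry (R : realType) n (a : 'rV[R]_n) (c : R) :
  c ^+ 2 = 1 -> forall A : set 'rV[R]_n, measurable A ->
  borel_lebesgue n ((fun x => a + c *: x) @^-1` A) = borel_lebesgue n A.
Proof.
move=> c2; elim: n a => [|n IHn] a A mA.
  congr (borel_lebesgue 0 _); apply/seteqP.
  by split => x /=; rewrite [x]thinmx0 [a + _]thinmx0.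
have mcA : measurable (@consR R n @^-1` A).
  by rewrite -[X in measurable X]setTI; exact: measurable_consR.
rewrite /= /borel_lebesgueS /pushforward /product_measure1.
pose s t := a 0 0 + c * t.
pose h (t : measurableTypeR R) :=
  borel_lebesgue n (xsection (@consR R n @^-1` A) t).
have mh : measurable_fun setT h by exact: measurable_fun_xsection.
have ms : measurable_fun setT (s : measurableTypeR R -> measurableTypeR R).
  exact: (measurable_funD (measurable_cst _)
           (measurable_funM (measurable_cst _) (@measurable_id _ _ setT))).
transitivity (\int[lebesgue_measure]_t h (s t))%E; last first.
  rewrite -(@ge0_integral_pushforward _ _ (measurableTypeR R) (measurableTypeR R)
    R s ms lebesgue_measure setT h)//.
  apply: eq_measure_integral => B mB _.
  exact: lebesgue_measure_isometry.
apply: eq_integral => t _ /=.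
apply: etrans (IHn (rsubmx (a : 'rV_(1 + n))) _ (measurable_xsection _ mcA)).
congr (borel_lebesgue n _); apply/seteqP.
have E x : a + c *: consR (t, x) = consR (s t, rsubmx (a : 'rV_(1 + n)) + c *: x).
  apply/rowP => i; rewrite [LHS]mxE [X in _ + X]mxE; have [j ->|->] := unliftP ord0 i.
    rewrite !consRS/= !mxE; congr (a _ _ + _); exact/val_inj.
  by rewrite !consR0.
by split => x; rewrite /xsection/= !in_setE/= E.
Qed.

(** Preimages of covers are covers of the same total measure; the converse
    inequality follows because the inverse map has the same form. *)
Lemma outer_borel_lebesgue_isometry (R : realType) n (a : 'rV[R]_n) (c : R)
    (X : set 'rV[R]_n) : c ^+ 2 = 1 ->
  (borel_lebesgue n)^*%mu ((fun x => a + c *: x) @^-1` X) =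
  (borel_lebesgue n)^*%mu X.
Proof.
move=> c2.
have le b (Y : set 'rV[R]_n) :
    ((borel_lebesgue n)^*%mu ((fun x => b + c *: x)%R @^-1` Y) <=
     (borel_lebesgue n)^*%mu Y)%E.
  apply: ereal_inf_le_tmp => _ [A [mA YA] <-].
  exists (fun k => (fun x => b + c *: x) @^-1` A k).
    split=> [k|x /= Yx].
      rewrite -[X in measurable X]setTI.
      by apply: measurable_isometry => //; exact: measurable_id.
    by have [k _ Ak] := YA _ Yx; exists k.
  by apply: eq_eseriesr => k _; exact: borel_lebesgue_isometry.
apply/eqP; rewrite eq_le le/=.
apply: le_trans (le (- (c *: a)) _).
rewrite -comp_preimage (_ : _ \o _ = id) ?preimage_id//.
apply/funext => x /=.
by rewrite scalerDr scalerN !scalerA -expr2 c2 !scale1r addrA subrr add0r.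
Qed.

(** The Caratheodory criterion for the preimage of [A] against [X] is the one for
    [A] against the image of [X]. *)
Lemma lebesgue_measurable_isometry (R : realType) n (a : 'rV[R]_n) (c : R) :
  c ^+ 2 = 1 ->
  measurable_fun setT
    (fun x : lebesgue_rV R n => (a + c *: (x : 'rV[R]_n)) : lebesgue_rV R n).
Proof.
move=> c2 _ A mA; rewrite setTI.
have {}mA : ((borel_lebesgue n)^*%mu).-caratheodory A by exact: mA.
suff : ((borel_lebesgue n)^*%mu).-caratheodory
    ((fun x : 'rV[R]_n => a + c *: x) @^-1` A) by [].
move=> X.
have E (Y : set 'rV[R]_n) : (fun x => a + c *: x) @^-1`
    (((fun x => - (c *: a) + c *: x) @^-1` X) `&` Y) =
    X `&` (fun x => a + c *: x) @^-1` Y.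
  rewrite preimage_setI -comp_preimage (_ : _ \o _ = id) ?preimage_id//.
  apply/funext => x /=.
  by rewrite scalerDr !scalerA -expr2 c2 !scale1r addrA addNr add0r.
rewrite -(outer_borel_lebesgue_isometry (- (c *: a)) X c2) (mA _).
rewrite -(outer_borel_lebesgue_isometry a (_ `&` A) c2) E.
by rewrite -(outer_borel_lebesgue_isometry a (_ `&` ~` A) c2) E.
Qed.

(** Positive and negative parts are transported separately, so that the identity
    holds for every measurable function. *)
Lemma integral_isometry (R : realType) n (a : 'rV[R]_n) (c : R)
    (f : 'rV[R]_n -> \bar R) : c ^+ 2 = 1 ->
  measurable_fun setT (f : lebesgue_rV R n -> \bar R) ->
  (\int[@lebesgue_vol R n]_x f (a + c *: x)%R = \int[@lebesgue_vol R n]_x f x)%E.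
Proof.
move=> c2.
have nneg (g : lebesgue_rV R n -> \bar R) : measurable_fun setT g ->
    (forall x, 0 <= g x)%E ->
    (\int[@lebesgue_vol R n]_x g (a + c *: x)%R =
     \int[@lebesgue_vol R n]_x g x)%E.
  move=> mg g0.
  have mT := lebesgue_measurable_isometry a c2.
  rewrite -(ge0_integral_pushforward mT lebesgue_vol measurableT)//.
  apply: eq_measure_integral => A mA _.
  exact: outer_borel_lebesgue_isometry.
move=> mf; rewrite integralE [RHS]integralE; congr (_ - _)%E.
- have <- := nneg _ (measurable_funepos mf) (funepos_ge0 _).
  by apply: eq_integral => x _; rewrite ?funeposE ?funenegE.
- have <- := nneg _ (measurable_funeneg mf) (funeneg_ge0 _).
  by apply: eq_integral => x _; rewrite ?funeposE ?funenegE.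
Qed.

(** * Measurability and Fubini's theorem *)

(** An open set is the union of the rational boxes that it contains. *)
Lemma open_measurable_rV (R : realType) n (O : set 'rV[R]_n) :
  open O -> measurable O.
Proof.
move=> oO.
pose B (q : 'rV[rat]_n * nat) : set 'rV[R]_n :=
  [set y | forall i, `|y 0 i - ratr (q.1 0 i)| < q.2.+1%:R^-1].
have mB q : measurable (B q).
  rewrite (_ : B q = \big[setI/setT]_(i < n) ((fun x : 'rV[R]_n => x 0 i) @^-1`
     [set t | `|t - ratr (q.1 0 i)| < q.2.+1%:R^-1])).
    apply: bigsetI_measurable => i _; rewrite -[X in measurable X]setTI.
    apply: (@measurable_rV_coor R n i) => //; apply: open_measurable.
    rewrite (_ : mkset _ = ball (ratr (q.1 0 i) : R) q.2.+1%:R^-1).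
      exact: ball_open.
    by apply/seteqP; split => t; rewrite /ball/= distrC.
  apply/seteqP; split => x /=; rewrite -bigcap_seq /= => Bx i.
    by move=> _; exact: Bx.
  by apply: Bx; rewrite /= mem_index_enum.
pose C (k : nat) : set 'rV[R]_n :=
  if unpickle k is Some q then (if `[< B q `<=` O >] then B q else set0) else set0.
rewrite (_ : O = \bigcup_k C k).
  apply: bigcupT_measurable => k; rewrite /C.
  by case: (unpickle k) => [q|//]; case: ifP.
apply/seteqP; split => [x Ox|x [k _]]; last first.
  by rewrite /C; case: (unpickle k) => // q; case: ifPn => // /asboolP; exact.
have /nbhs_ballP[e /= e0 xeO] : nbhs x O by exact: open_nbhs_nbhs.
have [m me] : exists m, m.+1%:R^-1 < e / 2 :> R.
  have := near_infty_natSinv_lt (PosNum (divr_gt0 e0 (ltr0n R 2))) => /=.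
  by move=> [N _ /(_ N)] => h; exists N; apply: h => /=.
have [d dE] : exists d : R, d = m.+1%:R^-1 by eexists.
have d0 : 0 < d by rewrite dE invr_gt0.
rewrite -dE in me.
have hq i : exists q : rat, `|x 0 i - ratr q| < d.
  have : x 0 i - d < x 0 i + d by lra.
  move=> /rat_in_itvoo[q]; rewrite in_itv/= => /andP[h1 h2]; exists q.
  rewrite ltr_norml; apply/andP; split; lra.
pose q : 'rV[rat]_n := \row_i projT1 (cid (hq i)).
have qE i : `|x 0 i - ratr (q 0 i)| < d.
  by rewrite mxE; case: cid.
have sB : B (q, m) `<=` O.
  move=> y By; apply: xeO; split=> // i j; rewrite ord1.
  rewrite /ball/= (le_lt_trans (ler_distD (ratr (q 0 j)) _ _))//.
  by have := qE j; have := By j; rewrite /= -dE [`|y 0 j - _|]distrC; lra.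
exists (pickle (q, m)) => //; rewrite /C pickleK.
by case: asboolP => // _ i /=; rewrite -dE; exact: qE.
Qed.

Lemma continuous_measurable_rV (R : realType) n (f : 'rV[R]_n -> R) :
  continuous f -> measurable_fun setT f.
Proof.
move=> /continuousP cf; apply: (measurability _ (RGenOpens.measurableE R)).
move=> _ [_ [a [b ->] <-]]; rewrite setTI; apply: open_measurable_rV.
exact/cf/interval_open.
Qed.

Section lebesgue_rV_measurability.
Context {R : realType} {n : nat}.
Implicit Types f : 'rV[R]_n -> R.

Lemma measurable_lebesgue_id :
  measurable_fun [set: lebesgue_rV R n] (idfun : lebesgue_rV R n -> 'rV[R]_n).
Proof.
by move=> _ A mA; rewrite setTI; apply: sub_caratheodory; exact: sub_sigma_algebra.
Qed.

Lemma continuous_lebesgue_measurable f : continuous f -> lebesgue_measurable f.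
Proof.
move=> /continuous_measurable_rV mf.
exact: (measurableT_comp mf measurable_lebesgue_id).
Qed.

End lebesgue_rV_measurability.

(** A bound by a product of integrable functions makes every section integrable,
    and not only almost every one, so that iterated integrals of real functions
    can be handled without exceptional null sets. *)
Section dominated_fubini.
Context d1 d2 (T1 : measurableType d1) (T2 : measurableType d2) (R : realType).
Variables (m1 : {sigma_finite_measure set T1 -> \bar R})
  (m2 : {sigma_finite_measure set T2 -> \bar R}).
Variables (F : T1 -> T2 -> R) (a : T1 -> R) (b : T2 -> R).
Hypotheses (mF : measurable_fun setT (fun p : T1 * T2 => F p.1 p.2))
  (ia : m1.-integrable setT (EFin \o a)) (ib : m2.-integrable setT (EFin \o b))
  (Fab : forall x y, `|F x y| <= a x * b y).

Lemma dominated_integrable_section x : m2.-integrable setT (EFin \o F x).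
Proof.
apply: (le_integrable _ _ _ (integrableZl measurableT (a x) ib)) => //.
  by apply/measurable_EFinP; exact: (measurableT_comp mF (pair1_measurable x)).
move=> y _ /=; rewrite lee_fin (le_trans (Fab x y))//; exact: ler_norm.
Qed.

Lemma dominated_integrable_prod :
  (m1 \x m2)%E.-integrable setT (fun p => (F p.1 p.2)%:E).
Proof.
apply/integrable12ltyP; first exact/measurable_EFinP.
have b0 : (0 <= \int[m2]_y `|(b y)%:E|)%E by exact: integral_ge0.
have boo : (\int[m2]_y `|(b y)%:E|)%E \is a fin_num.
  by rewrite ge0_fin_numE//; case/integrableP: ib.
have mb : measurable_fun setT (fun y => `|(b y)%:E|%E).
  by apply: measurableT_comp => //; case/integrableP: ib.
have ma : measurable_fun setT (fun y => `|(a y)%:E|%E).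
  by apply: measurableT_comp => //; case/integrableP: ia.
apply: (@le_lt_trans _ _
  (\int[m1]_x (`|(a x)%:E| * \int[m2]_y `|(b y)%:E|))%E); last first.
  rewrite ge0_integralZr//; apply: lte_mul_pinfty => //.
  - exact: integral_ge0.
  - by rewrite ge0_fin_numE//; [case/integrableP: ia|exact: integral_ge0].
  - by case/integrableP: ib.
apply: ge0_le_integral => //.
- by move=> x _; exact: integral_ge0.
- apply: (measurable_fun_fubini_tonelli_F
    (fun p : T1 * T2 => `|(F p.1 p.2)%:E|%E)) => //.
  by apply: measurableT_comp => //; exact/measurable_EFinP.
- exact: emeasurable_funM.
- move=> x _; rewrite -ge0_integralZl//; apply: ge0_le_integral => //.
  + apply: measurableT_comp => //.
    by case/integrableP: (dominated_integrable_section x).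
  + exact: emeasurable_funM.
  + move=> y _; rewrite -abseM lee_fin (le_trans (Fab x y))//.
    exact: ler_norm.
Qed.

Lemma dominated_EFin_Rintegral x :
  (\int[m2]_y F x y)%:E = (\int[m2]_y (F x y)%:E)%E.
Proof.
by rewrite fineK//; apply: integrable_fin_num (dominated_integrable_section x).
Qed.

Lemma dominated_integrable_Rintegral :
  m1.-integrable setT (EFin \o (fun x => \int[m2]_y F x y)).
Proof.
apply: eq_integrable (integrable_fubini_F dominated_integrable_prod) => // x _ /=.
by rewrite dominated_EFin_Rintegral.
Qed.

End dominated_fubini.

Lemma dominated_fubini d1 d2 (T1 : measurableType d1) (T2 : measurableType d2)
    (R : realType) (m1 : {sigma_finite_measure set T1 -> \bar R})
    (m2 : {sigma_finite_measure set T2 -> \bar R})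
    (F : T1 -> T2 -> R) (a : T1 -> R) (b : T2 -> R) :
  measurable_fun setT (fun p : T1 * T2 => F p.1 p.2) ->
  m1.-integrable setT (EFin \o a) -> m2.-integrable setT (EFin \o b) ->
  (forall x y, `|F x y| <= a x * b y) ->
  \int[m1]_x \int[m2]_y F x y = \int[m2]_y \int[m1]_x F x y.
Proof.
move=> mF ia ib Fab; rewrite /Rintegral; congr fine.
have mF' : measurable_fun setT (fun p : T2 * T1 => F p.2 p.1).
  exact: (measurableT_comp mF (@measurable_swap _ _ T2 T1)).
have Fba y x : `|F x y| <= b y * a x by rewrite mulrC.
under eq_integral do
  rewrite -/(Rintegral _ _ _) (dominated_EFin_Rintegral mF ib Fab).
under [RHS]eq_integral do rewrite -/(Rintegral _ _ _)
  (@dominated_EFin_Rintegral _ _ _ _ _ m1 (fun y x => F x y) b a mF' ia Fba).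
exact: (Fubini (dominated_integrable_prod mF ia ib Fab)).
Qed.

(** * Second differences of functions with bounded partial derivatives *)

Section differentiation_along_lines.
Context {R : realType} {n : nat}.
Implicit Types (u g : 'rV[R]_n -> R) (x y v w : 'rV[R]_n) (r t : R).

(** Directional derivatives are derivatives of functions of one variable, for
    which the chain rule and the mean value theorem hold. *)
Lemma is_derive_line u y v t d :
  is_derive (y + t *: v) v u d <-> is_derive t 1 (fun t : R => u (y + t *: v)) d.
Proof.
have E : (fun h : R => h^-1 *: (((fun t : R => u (y + t *: v)) \o shift t) (h *: 1)
      - u (y + t *: v)))
  = (fun h => h^-1 *: ((u \o shift (y + t *: v)) (h *: v) - u (y + t *: v))).
  by apply/funext => h /=; rewrite [_ *: 1]mulr1 scalerDl addrCA.
by split => -[D e]; constructor; move: D e; rewrite /derivable /derive E.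
Qed.

Lemma is_derive_affine u y v (a : R) x d :
  is_derive (a *: x + y) v u d ->
  is_derive x v (fun x => u (a *: x + y)) (d * a).
Proof.
move=> D; rewrite -[x]addr0 -[X in x + X](scale0r v); apply/is_derive_line.
have Da : is_derive (0 : R) 1 (fun t : R => a * t) a.
  by apply: is_derive_eq; rewrite [_ *: 1]mulr1.
have D' : is_derive (a * 0) 1 (fun t : R => u (a *: x + y + t *: v)) d.
  by apply/is_derive_line; rewrite mulr0 scale0r addr0.
have := @is_derive1_comp R _ _ 0 d a D' Da.
congr is_derive; apply/funext => t /=; congr u.
by rewrite scalerDr scalerA addrAC.
Qed.

Lemma continuous_bounded_ball u r : continuous u ->
  exists2 M : R, 0 <= M & forall x, `|x| <= r -> `|u x| <= M.
Proof.
move=> cu.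
have cB : compact [set x : 'rV[R]_n | `|x| <= r].
  apply: bounded_closed_compact.
    by exists r; split => [|s rs x /= /le_trans]; [exact: num_real|apply; exact: ltW].
  apply: (@closed_comp _ _ (fun x : 'rV[R]_n => `|x|) [set t | t <= r]).
    by move=> x _; exact: norm_continuous.
  exact: closed_le.
have /compact_bounded[M [_ hM]] : compact (u @` [set x : 'rV[R]_n | `|x| <= r]).
  by apply: continuous_compact => //; exact: continuous_subspaceT.
exists (`|M| + 1); first by rewrite addr_ge0.
move=> x xr; apply: hM; last by exists x.
by rewrite (le_lt_trans (ler_norm _))// ltrDl.
Qed.

Lemma row_norm_le x r : 0 <= r -> (forall i, `|x 0 i| <= r) -> `|x| <= r.
Proof.
move=> r0 xr; rewrite [leLHS]/Num.norm /= mx_normrE; apply/bigmax_leP; split => //.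
by move=> [i j] _ /=; rewrite ord1.
Qed.

Lemma coord_norm_le x i : `|x 0 i| <= `|x|.
Proof.
by rewrite [leRHS]/Num.norm /= mx_normrE; apply/bigmax_geP; right => /=; exists (0, i).
Qed.

Lemma mvt_line u v y t : (forall x, derivable u x v) ->
  exists2 s, `|s| <= `|t| & u (y + t *: v) - u y = t * 'D_v u (y + s *: v).
Proof.
move=> du; pose f (s : R) := u (y + s *: v).
have df (s : R) : is_derive s 1 f ('D_v u (y + s *: v)).
  exact/is_derive_line/derivableP.
have cf (a b : R) : {within `[a, b], continuous f}.
  by apply: derivable_within_continuous => s _; case: (df s).
have [t0|/ltW t0] := leP 0 t.
- have [s s0t E] := MVT_segment t0 (fun s _ => df s) (cf _ _).
  exists s; last by rewrite mulrC -[t in RHS]subr0 -E /f scale0r addr0.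
  by move: s0t; rewrite in_itv/= => /andP[s0 st]; rewrite !ger0_norm.
- have [s s0t E] := MVT_segment t0 (fun s _ => df s) (cf _ _).
  exists s.
    move: s0t; rewrite in_itv/= => /andP[s0 st].
    by rewrite !ler0_norm ?lerN2.
  rewrite -opprB -[X in - (u X - _)](_ : y + 0 *: v = _) ?scale0r ?addr0//.
  by rewrite -/(f t) -{1}[y]addr0 -(scale0r v) -/(f 0) E sub0r mulrN opprK mulrC.
Qed.

(** The broken line from the origin to [w] that turns one coordinate on at a
    time: its steps only involve partial derivatives. *)
Definition truncate w k : 'rV[R]_n := \row_i (if (i < k)%N then w 0 i else 0).

Lemma truncate0 w : truncate w 0 = 0.
Proof. by apply/rowP => i; rewrite !mxE. Qed.

Lemma truncate_all w : truncate w n = w.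
Proof. by apply/rowP => i; rewrite !mxE ltn_ord. Qed.

Lemma truncateS w (k : 'I_n) :
  truncate w k.+1 = truncate w k + w 0 k *: delta_mx 0 k.
Proof.
apply/rowP => i; rewrite !mxE ltnS leq_eqVlt eqxx/=.
have [->|ik] := eqVneq i k; first by rewrite eqxx ltnn add0r mulr1.
by rewrite (negbTE (ik : nat_of_ord i != k)) mulr0 addr0.
Qed.

Lemma truncate_norm w k : `|truncate w k| <= `|w|.
Proof.
apply: row_norm_le => // i; rewrite mxE; case: ifP => _; last by rewrite normr0.
exact: coord_norm_le.
Qed.

Lemma delta_norm t (i : 'I_n) : `|t *: (delta_mx 0 i : 'rV[R]_n)| <= `|t|.
Proof.
rewrite normrZ -[leRHS]mulr1 ler_wpM2l//; apply: row_norm_le => // j.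
by rewrite mxE; case: (_ && _); rewrite ?normr1 ?normr0.
Qed.

(** Only partial derivatives are at hand, so increments are telescoped along the
    broken line. *)
Lemma lipschitz_partial u M :
  (forall i x, derivable u x (delta_mx 0 i)) ->
  (forall i x, `|'D_(delta_mx 0 i) u x| <= M) ->
  forall x w, `|u (x + w) - u x| <= n%:R * M * `|w|.
Proof.
move=> du uM x w.
have -> : u (x + w) - u x =
    \sum_(k < n) (u (x + truncate w k.+1) - u (x + truncate w k)).
  rewrite -(big_mkord xpredT
    (fun k => u (x + truncate w k.+1) - u (x + truncate w k))).
  by rewrite telescope_sumr// truncate_all truncate0 addr0.
apply: (le_trans (ler_norm_sum _ _ _)).
have -> : n%:R * M * `|w| = \sum_(k < n) (M * `|w|).
  by rewrite sumr_const card_ord -[RHS]mulr_natl mulrA.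
apply: ler_sum => k _.
rewrite truncateS addrA.
have [s _ ->] := mvt_line (x + truncate w k) (w 0 k) (du k).
by rewrite normrM mulrC ler_pM// coord_norm_le.
Qed.

Definition second_diff u x w : R := 2 * u x - u (x + w) - u (x - w).

(** The increments from [x] to [x + w] and from [x] to [x - w] are telescoped along
    opposite broken lines and paired step by step: the mean value theorem writes
    each pair as [w 0 k] times the difference of a partial derivative between two
    points at distance at most [4 * `|w|]. *)
Lemma second_diff_le u M :
  (forall i x, derivable u x (delta_mx 0 i)) ->
  (forall i j x, derivable ('D_(delta_mx 0 i) u) x (delta_mx 0 j)) ->
  (forall i j x, `|'D_(delta_mx 0 j) ('D_(delta_mx 0 i) u) x| <= M) ->
  0 <= M ->
  forall x w, `|second_diff u x w| <= 4 * n%:R ^+ 2 * M * `|w| ^+ 2.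
Proof.
move=> du ddu uM M0 x w.
have -> : second_diff u x w = - \sum_(k < n)
    (u (x + truncate w k.+1) - u (x + truncate w k) +
     (u (x - truncate w k.+1) - u (x - truncate w k))).
  rewrite -(big_mkord xpredT
    (fun k => u (x + truncate w k.+1) - u (x + truncate w k) +
     (u (x - truncate w k.+1) - u (x - truncate w k)))).
  rewrite big_split/= !telescope_sumr// truncate_all truncate0 subr0 addr0.
  by rewrite /second_diff; ring.
rewrite normrN; apply: (le_trans (ler_norm_sum _ _ _)).
have -> : 4 * n%:R ^+ 2 * M * `|w| ^+ 2 =
    \sum_(k < n) `|w| * (n%:R * M * (4 * `|w|)).
  by rewrite sumr_const card_ord -[RHS]mulr_natl; ring.
apply: ler_sum => k _.
rewrite truncateS opprD (addrA x (truncate w k)) (addrA x (- truncate w k)).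
rewrite -scaleNr.
have [s sw ->] := mvt_line (x + truncate w k) (w 0 k) (du k).
have [t tw ->] := mvt_line (x - truncate w k) (- w 0 k) (du k).
rewrite mulNr -mulrBr normrM ler_pM ?coord_norm_le//.
pose p := x - truncate w k + t *: delta_mx 0 k.
pose h := truncate w k + truncate w k + (s - t) *: delta_mx 0 k.
rewrite -/p (_ : x + _ + _ = p + h); last first.
  rewrite /p /h; move: (truncate w k) (delta_mx 0 k) => a b.
  by apply/rowP => i; rewrite !mxE; ring.
apply: (le_trans (lipschitz_partial (ddu k) (uM k) _ _)).
apply: ler_wpM2l; first by rewrite mulr_ge0.
apply: (le_trans (ler_normD _ _)); apply: (@le_trans _ _ (2 * `|w| + 2 * `|w|)).
  apply: lerD.
    by apply: (le_trans (ler_normD _ _)); rewrite mulr_natl mulr2n lerD// truncate_norm.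
  apply: (le_trans (delta_norm _ _)); apply: (le_trans (ler_normB _ _)).
  rewrite normrN in tw; have := coord_norm_le w k; lra.
by lra.
Qed.

End differentiation_along_lines.

(** * Test functions *)

Section test_functions.
Context {R : realType} {n : nat}.
Implicit Types (u v xi : 'rV[R]_n -> R) (x y w : 'rV[R]_n) (a r t : R).

Lemma iter_partial_affine u a y : smooth u ->
  forall s, iter_partial s (fun x => u (a *: x + y)) =
    (fun x => a ^+ size s * iter_partial s u (a *: x + y)).
Proof.
move=> su; elim=> [|i s IHs]; first by apply/funext => x; rewrite expr0 mul1r.
apply/funext => x; rewrite /= IHs.
have [_ /(_ i (a *: x + y)) /derivableP D] := su s.
have := is_deriveZ (a ^+ size s) (is_derive_affine D).
by move=> /@derive_val ->; rewrite exprS /GRing.scale/=; ring.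
Qed.

Lemma smooth_affine u a y : smooth u -> smooth (fun x => u (a *: x + y)).
Proof.
move=> su s; rewrite iter_partial_affine//; have [cs ds] := su s; split.
  move=> x; have caff : (fun x => a *: x + y) z @[z --> x] --> a *: x + y.
    exact: (cvgD (cvgZ (cvg_cst a) cvg_id) (cvg_cst _)).
  exact: (cvgM (cvg_cst _) (cvg_comp _ _ caff (cs _))).
move=> i x; have /derivableP D := ds i (a *: x + y).
by have [] := is_deriveZ (a ^+ size s) (is_derive_affine D).
Qed.

(** Every iterated partial derivative of a product is a finite sum of products of
    iterated partial derivatives; the list of the pairs of multi-indices is
    tracked without collecting equal terms. *)
Section product.
Variables (u v : 'rV[R]_n -> R) (su : smooth u) (sv : smooth v).

Let leibniz (L : seq (seq 'I_n * seq 'I_n)) x :=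
  \sum_(p <- L) iter_partial p.1 u x * iter_partial p.2 v x.

Let leibniz_nil : leibniz [::] = cst 0.
Proof. by apply/funext => x; rewrite /leibniz big_nil. Qed.

Let leibniz_cons p L : leibniz (p :: L) =
  (fun x => iter_partial p.1 u x * iter_partial p.2 v x + leibniz L x).
Proof. by apply/funext => x; rewrite /leibniz big_cons. Qed.

Let leibniz_continuous L : continuous (leibniz L).
Proof.
elim: L => [|p L IHL] x; first by rewrite leibniz_nil; exact: cst_continuous.
rewrite leibniz_cons.
exact: (cvgD (cvgM ((su p.1).1 x) ((sv p.2).1 x)) (IHL x)).
Qed.

Let leibniz_derive L i : exists L', forall x,
  is_derive x (delta_mx 0 i) (leibniz L) (leibniz L' x).
Proof.
elim: L => [|p L [L' IHL]].
  by exists [::] => x; rewrite leibniz_nil; exact: is_derive_cst.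
exists ((i :: p.1, p.2) :: (p.1, i :: p.2) :: L') => x.
rewrite !leibniz_cons /=.
have /derivableP Du := (su p.1).2 i x.
have /derivableP Dv := (sv p.2).2 i x.
apply: (@is_derive_eq _ _ _ _ _ _ _ _ (is_deriveD (is_deriveM Du Dv) (IHL x))).
by rewrite /GRing.scale/=; ring.
Qed.

Let iter_partialM s : exists L, iter_partial s (fun x => u x * v x) = leibniz L.
Proof.
elim: s => [|i s [L IHs]].
  by exists [:: ([::], [::])]; apply/funext => x; rewrite /leibniz big_seq1.
have [L' D] := leibniz_derive L i; exists L'; apply/funext => x /=.
by rewrite IHs; have /@derive_val := D x.
Qed.

Lemma smoothM : smooth (fun x => u x * v x).
Proof.
move=> s; have [L ->] := iter_partialM s; split; first exact: leibniz_continuous.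
by move=> i x; have [L' D] := leibniz_derive L i; have [] := D x.
Qed.

End product.

Lemma smooth_continuous u : smooth u -> continuous u.
Proof. by move=> /(_ [::])[]. Qed.

Lemma test_functionP xi : test_function xi <->
  smooth xi /\ exists2 r : R, 0 < r & forall x, r <= `|x| -> xi x = 0.
Proof.
split=> [[sxi cxi]|[sxi [r r0 rxi]]]; split=> //.
  have /compact_bounded[M [_ hM]] := cxi.
  exists (`|M| + 2) => [|x xM]; first by rewrite ltr_wpDl.
  apply/eqP; apply: contrapT => /negP xi0.
  have MM : M < `|M| + 1 by rewrite (le_lt_trans (ler_norm M))// ltrDl.
  have cx : closure [set x | xi x != 0] x by exact: subset_closure.
  by have := hM _ MM x cx; rewrite /=; lra.
apply: bounded_closed_compact; last exact: closed_closure.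
exists r; split=> [|s rs x cx /=]; first exact: num_real.
suff : closure [set x | xi x != 0] `<=` [set x : 'rV[R]_n | `|x| <= s] by exact.
rewrite closureE; apply: smallest_sub => /=.
  apply: (@closed_comp _ _ (fun x : 'rV[R]_n => `|x|) [set t | t <= s]).
    by move=> y _; exact: norm_continuous.
  exact: closed_le.
move=> y /= xiy; rewrite leNgt; apply: contra xiy => sy.
by rewrite rxi// (le_trans (ltW rs))// ltW.
Qed.

(** The complement of a closed ball is open, so partial derivatives vanish where
    the function does. *)
Lemma iter_partial_support xi r : (forall x, r < `|x| -> xi x = 0) ->
  forall s x, r < `|x| -> iter_partial s xi x = 0.
Proof.
move=> xi0; elim=> [|i s IHs] x rx /=; first exact: xi0.
rewrite (@near_eq_derive _ _ _ _ (cst 0)) ?derive_cst//.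
have oA : open [set y : 'rV[R]_n | r < `|y|].
  apply: (@open_comp _ _ (fun x : 'rV[R]_n => `|x|) [set t | r < t]).
    by move=> y _; exact: norm_continuous.
  exact: open_gt.
have : nbhs x [set y : 'rV[R]_n | r < `|y|] by exact: open_nbhs_nbhs.
by apply: filterS => y; exact: IHs.
Qed.

Lemma test_function_iter_bounded xi s : test_function xi ->
  exists2 M : R, 0 <= M & forall x, `|iter_partial s xi x| <= M.
Proof.
move=> /test_functionP[sxi [r r0 rxi]].
have [M M0 hM] := continuous_bounded_ball r (sxi s).1.
exists M => // x; have [/hM//|rx] := leP `|x| r.
rewrite (@iter_partial_support xi r) ?normr0// => y ry.
by rewrite rxi// ltW.
Qed.

Lemma bounded_family (I : finType) (P : I -> R -> Prop) :
  (forall i M M', P i M -> M <= M' -> P i M') ->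
  (forall i, exists2 M : R, 0 <= M & P i M) ->
  exists2 M : R, 0 <= M & forall i, P i M.
Proof.
move=> homoP exP; pose M i := projT1 (cid2 (exP i)).
have M0 i : 0 <= M i by rewrite /M; case: cid2.
exists (\sum_i M i) => [|i]; first exact: sumr_ge0.
apply: (homoP i (M i)); first by rewrite /M; case: cid2.
by rewrite (bigD1 i)//= lerDl sumr_ge0.
Qed.

Lemma test_function_lipschitz xi : test_function xi ->
  exists2 C : R, 0 <= C & forall x w, `|xi (x + w) - xi x| <= C * `|w|.
Proof.
move=> txi.
have [M M0 hM] := @bounded_family 'I_n
  (fun i M => forall x, `|iter_partial [:: i] xi x| <= M)
  (fun i M M' h MM' x => le_trans (h x) MM')
  (fun i => test_function_iter_bounded [:: i] txi).
exists (n%:R * M); first by rewrite mulr_ge0.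
by apply: lipschitz_partial hM => i x; have [/(_ [::])[_]] := txi.
Qed.

Lemma test_function_second_diff xi : test_function xi ->
  exists2 C : R, 0 <= C & forall x w, `|second_diff xi x w| <= C * `|w| ^+ 2.
Proof.
move=> txi.
have [M M0 hM] := @bounded_family ('I_n * 'I_n)%type
  (fun p M => forall x, `|iter_partial [:: p.2; p.1] xi x| <= M)
  (fun i M M' h MM' x => le_trans (h x) MM')
  (fun p => test_function_iter_bounded [:: p.2; p.1] txi).
exists (4 * n%:R ^+ 2 * M); first by rewrite !mulr_ge0// exprn_ge0.
have [sxi _] := txi.
apply: second_diff_le => //; first exact: (sxi [::]).2.
- by move=> i; exact: (sxi [:: i]).2.
- by move=> i j; exact: (hM (i, j)).
Qed.

End test_functions.

(** * Integration on the completed Lebesgue space *)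

Section integration.
Context {R : realType} {n : nat}.
Implicit Types (f g : 'rV[R]_n -> R) (x y w : 'rV[R]_n) (a r t M : R).
Local Notation mu := (@lebesgue_vol R n).

Lemma integrable_measurable f : lebesgue_integrable setT f -> lebesgue_measurable f.
Proof. by case/integrableP => /measurable_EFinP. Qed.

Lemma le_lebesgue_integrable f g : lebesgue_measurable f ->
  lebesgue_integrable setT g -> (forall x, `|f x| <= g x) ->
  lebesgue_integrable setT f.
Proof.
move=> mf ig fg.
apply: (@le_integrable _ _ _ mu setT measurableT (EFin \o f) (EFin \o g) _ _ ig).
  exact/measurable_EFinP.
by move=> x _ /=; rewrite lee_fin (le_trans (fg x))// ler_norm.
Qed.

(** Row vectors carry a Borel and a Lebesgue measurable structure. Linearity and
    monotonicity of the integral are restated for functions on row vectors so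
    that the Lebesgue structure is fixed once. *)
Lemma lebesgue_integrableD f g : lebesgue_integrable setT f ->
  lebesgue_integrable setT g -> lebesgue_integrable setT (fun x => f x + g x).
Proof. exact: (integrableD measurableT). Qed.

Lemma lebesgue_integrableB f g : lebesgue_integrable setT f ->
  lebesgue_integrable setT g -> lebesgue_integrable setT (fun x => f x - g x).
Proof. exact: (integrableB measurableT). Qed.

Lemma lebesgue_integrableZ f a : lebesgue_integrable setT f ->
  lebesgue_integrable setT (fun x => a * f x).
Proof. exact: (integrableZl measurableT a). Qed.

Lemma lebesgue_integralD f g : lebesgue_integrable setT f ->
  lebesgue_integrable setT g ->
  \int[mu]_x (f x + g x) = \int[mu]_x f x + \int[mu]_x g x.
Proof. exact: (RintegralD measurableT). Qed.

Lemma lebesgue_integralB f g : lebesgue_integrable setT f ->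
  lebesgue_integrable setT g ->
  \int[mu]_x (f x - g x) = \int[mu]_x f x - \int[mu]_x g x.
Proof. exact: (RintegralB measurableT). Qed.

Lemma lebesgue_integralZ f a : lebesgue_integrable setT f ->
  \int[mu]_x (a * f x) = a * \int[mu]_x f x.
Proof. exact: (RintegralZl a measurableT). Qed.

Lemma lebesgue_le_integral f g : lebesgue_integrable setT f ->
  lebesgue_integrable setT g -> (forall x, f x <= g x) ->
  \int[mu]_x f x <= \int[mu]_x g x.
Proof. by move=> If Ig fg; exact: (le_Rintegral measurableT If Ig). Qed.

Lemma lebesgue_integral_ext f g : (forall x, f x = g x) ->
  \int[mu]_x f x = \int[mu]_x g x.
Proof. by move=> /funext ->. Qed.

Lemma measurable_norm_rV : lebesgue_measurable (fun x : 'rV[R]_n => `|x|).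
Proof. by apply: continuous_lebesgue_measurable => x; exact: norm_continuous. Qed.

Lemma measurable_cube r :
  measurable ([set x : 'rV[R]_n | `|x| <= r] : set (lebesgue_rV R n)).
Proof.
have := measurable_norm_rV; rewrite /lebesgue_measurable => /(_ measurableT).
move=> /(_ [set t | t <= r]); rewrite setTI; apply.
by rewrite -set_itvNyc.
Qed.

Lemma lebesgue_vol_cube r : 0 <= r ->
  mu [set x : 'rV[R]_n | `|x| <= r] = ((2 * r) ^+ n)%:E.
Proof.
move=> r0; pose A (i : 'I_n) : set (measurableTypeR R) := `[- r, r]%classic.
have cubeE : [set x : 'rV[R]_n | `|x| <= r] = [set x | forall i, A i (x 0 i)].
  apply/seteqP; split => x /= h.
    by move=> i; rewrite /A /= in_itv/= -ler_norml (le_trans (coord_norm_le x i)).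
  by apply: row_norm_le => // i; have := h i; rewrite /A /= in_itv/= -ler_norml.
have mB : measurable [set x : 'rV[R]_n | forall i, A i (x 0 i)].
  rewrite (_ : mkset _ = \big[setI/setT]_(i < n)
      ((fun x : 'rV[R]_n => x 0 i) @^-1` A i)).
    apply: bigsetI_measurable => i _; rewrite -[X in measurable X]setTI.
    by apply: (@measurable_rV_coor R n i) => //; exact: measurable_itv.
  apply/seteqP; split => x /=; rewrite -bigcap_seq /= => Bx i.
    by move=> _; exact: Bx.
  by apply: Bx; rewrite /= mem_index_enum.
transitivity (borel_lebesgue n [set x : 'rV[R]_n | forall i, A i (x 0 i)]).
  by rewrite cubeE; exact: (@measurable_mu_extE _ R _ (borel_lebesgue n) _ mB).
rewrite borel_lebesgue_box; last by move=> i; exact: measurable_itv.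
rewrite (eq_bigr (fun=> (2 * r)%:E)); last first.
  move=> i _; rewrite /A lebesgue_measure_itv/= lte_fin opprK -mulr2n -mulr_natl.
  case: ltP => // rr; congr EFin; lra.
rewrite -[in RHS](card_ord n) -prodr_const.
by elim/big_ind2 : _ => // x1 x2 y1 y2 -> ->.
Qed.

Lemma cube_finite r : (mu [set x : 'rV[R]_n | `|x| <= r]%R < +oo)%E.
Proof.
have [r0|r0] := leP 0 r; first by rewrite lebesgue_vol_cube// ltry.
rewrite (_ : [set x : 'rV[R]_n | _] = set0) ?measure0 ?ltry//.
by apply/seteqP; split => x //= /(le_lt_trans)/(_ r0); rewrite normr_lt0.
Qed.

Lemma integrable_cube_indic r :
  lebesgue_integrable setT (\1_[set x : 'rV[R]_n | `|x| <= r]).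
Proof.
have mC := measurable_cube r.
apply/integrableP; split; first exact/measurable_EFinP/measurable_indicP.
under eq_integral do rewrite /= ger0_norm//.
by rewrite integral_indic// setIT; exact: cube_finite.
Qed.

Lemma integrableZ_cube M r :
  lebesgue_integrable setT (fun x => M * \1_[set x : 'rV[R]_n | `|x| <= r] x).
Proof. exact: (integrableZl measurableT M (integrable_cube_indic r)). Qed.

Lemma le_cube_indic f M r : (forall x, `|x| <= r -> `|f x| <= M) ->
  (forall x, r < `|x| -> f x = 0) ->
  forall x, `|f x| <= M * \1_[set x : 'rV[R]_n | `|x| <= r] x.
Proof.
move=> fM f0 x; rewrite indicE; have [xr|xr] := leP `|x| r.
  by rewrite mem_set// mulr1 fM.
by rewrite f0// normr0 memNset ?mulr0//= => /(lt_le_trans xr); rewrite ltxx.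
Qed.

Lemma integrable_bounded_support f M r : lebesgue_measurable f ->
  (forall x, `|x| <= r -> `|f x| <= M) -> (forall x, r < `|x| -> f x = 0) ->
  lebesgue_integrable setT f.
Proof.
move=> mf fM f0; apply: (le_lebesgue_integrable mf (integrableZ_cube M r)).
exact: le_cube_indic.
Qed.

Lemma Rintegral_isometry f x a : a ^+ 2 = 1 -> lebesgue_measurable f ->
  \int[mu]_y f (x + a *: y) = \int[mu]_y f y.
Proof.
move=> a2 mf; congr fine.
by apply: (integral_isometry x (f := EFin \o f) a2); exact/measurable_EFinP.
Qed.

Lemma integrable_isometry f x a : a ^+ 2 = 1 -> lebesgue_integrable setT f ->
  lebesgue_integrable setT (fun y => f (x + a *: y)).
Proof.
move=> a2 /integrableP[mf foo]; apply/integrableP; split.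
  exact: (measurableT_comp mf (lebesgue_measurable_isometry x a2)).
apply: le_lt_trans foo; rewrite le_eqVlt; apply/orP; left; apply/eqP.
apply: (integral_isometry x (f := fun y => `|(f y)%:E|%E) a2).
exact: measurableT_comp.
Qed.

Lemma Rintegral_translate f x : lebesgue_measurable f ->
  \int[mu]_y f (y + x) = \int[mu]_y f y.
Proof.
move=> mf; rewrite -[RHS](@Rintegral_isometry _ x 1) ?expr1n//.
by apply: eq_Rintegral => y _; rewrite scale1r addrC.
Qed.

Lemma Rintegral_reflect f x : lebesgue_measurable f ->
  \int[mu]_y f (x - y) = \int[mu]_y f y.
Proof.
move=> mf; rewrite -[RHS](@Rintegral_isometry _ x (-1)) ?sqrrN ?expr1n//.
by apply: eq_Rintegral => y _; rewrite scaleN1r.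
Qed.

Lemma integrable_translate f x : lebesgue_integrable setT f ->
  lebesgue_integrable setT (fun y => f (y + x)).
Proof.
move=> /(@integrable_isometry _ x 1 (expr1n _ _)).
by under eq_fun do rewrite scale1r addrC.
Qed.

Lemma integrable_reflect f x : lebesgue_integrable setT f ->
  lebesgue_integrable setT (fun y => f (x - y)).
Proof.
have c2 : (-1) ^+ 2 = 1 :> R by rewrite sqrrN expr1n.
move=> /(@integrable_isometry _ x (-1) c2).
by under eq_fun do rewrite scaleN1r.
Qed.

Lemma Rintegral_dominated_cvg (f_ : nat -> 'rV[R]_n -> R) f g :
  (forall k, lebesgue_measurable (f_ k)) -> lebesgue_measurable f ->
  (forall x, f_ k x @[k --> \oo] --> f x) -> lebesgue_integrable setT g ->
  (forall k x, `|f_ k x| <= g x) ->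
  \int[mu]_x f_ k x @[k --> \oo] --> \int[mu]_x f x.
Proof.
move=> mf_ mf f_f ig f_g.
have mE h : lebesgue_measurable h ->
  measurable_fun [set: lebesgue_rV R n] (EFin \o h) by move/measurable_EFinP.
have cE x : setT x -> (EFin \o f_ k) x @[k --> \oo] --> (EFin \o f) x.
  by move=> _; apply: cvg_EFin; [exact: nearW|exact: f_f].
have [if_ _ cf] := @dominated_convergence _ (lebesgue_rV R n) R mu setT measurableT
  (fun k => EFin \o f_ k) (EFin \o f) (EFin \o g)
  (fun k => mE _ (mf_ k)) (mE _ mf)
  (aeW mu cE) ig
  (aeW mu (fun x k _ => f_g k x)).
apply: fine_cvg; rewrite fineK//; exact: integrable_fin_num if_.
Qed.

End integration.

(** * The operator on test functions *)

Section operator.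
Context {R : realType} {n : nat}.
Implicit Types (f g H zeta : 'rV[R]_n -> R) (x y w : 'rV[R]_n) (a r t M : R).
Local Notation mu := (@lebesgue_vol R n).

Lemma enorm_sqr w : enorm w ^+ 2 = \sum_(i < n) w 0 i ^+ 2.
Proof. by rewrite sqr_sqrtr// sumr_ge0// => i _; exact: sqr_ge0. Qed.

Lemma enorm_ge0 w : 0 <= enorm w.
Proof. exact: sqrtr_ge0. Qed.

Lemma enormN w : enorm (- w) = enorm w.
Proof. by congr Num.sqrt; apply: eq_bigr => i _; rewrite mxE sqrrN. Qed.

Lemma norm_le_enorm w : `|w| <= enorm w.
Proof.
apply: row_norm_le => [|i]; first exact: enorm_ge0.
rewrite -(@ler_pXn2r _ 2)// ?nnegrE ?enorm_ge0//.
by rewrite real_normK ?num_real// enorm_sqr (bigD1 i)//= lerDl sumr_ge0// => j _;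
  exact: sqr_ge0.
Qed.

Lemma measurable_enorm : lebesgue_measurable (@enorm R n).
Proof.
have ms : lebesgue_measurable (fun w : 'rV[R]_n => \sum_(i < n) w 0 i ^+ 2).
  apply: measurable_sum => i; apply: measurable_funX.
  exact: (measurableT_comp (@measurable_rV_coor R n i) measurable_lebesgue_id).
apply: (measurableT_comp _ ms); apply: continuous_measurable_fun.
exact: sqrt_continuous.
Qed.

Lemma measurable_affine f x a : a ^+ 2 = 1 -> lebesgue_measurable f ->
  lebesgue_measurable (fun y => f (x + a *: y)).
Proof.
by move=> a2 mf; exact: (measurableT_comp mf (lebesgue_measurable_isometry x a2)).
Qed.

Lemma measurable_reflect f x : lebesgue_measurable f ->
  lebesgue_measurable (fun y => f (x - y)).
Proof.
have sqN1 : (-1) ^+ 2 = 1 :> R by rewrite sqrrN expr1n.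
by move=> /(measurable_affine x sqN1); under eq_fun do rewrite scaleN1r.
Qed.

Lemma measurable_translate f x : lebesgue_measurable f ->
  lebesgue_measurable (fun y => f (x + y)).
Proof.
by move=> /(measurable_affine x (expr1n _ _)); under eq_fun do rewrite scale1r.
Qed.

Section even_kernel.
Variable H : 'rV[R]_n -> R.
Hypotheses (mH : lebesgue_measurable H) (Heven : {ae mu, forall z, H z = H (- z)}).

Lemma even_kernel_symmetry f : lebesgue_measurable f ->
  \int[mu]_w (f (- w) * H w) = \int[mu]_w (f w * H w).
Proof.
move=> mf; have mfH : lebesgue_measurable (fun w => f w * H w).
  exact: measurable_funM mf mH.
have mfN : lebesgue_measurable (fun w => f (- w)).
  by have := measurable_reflect 0 mf; under eq_fun do rewrite sub0r.
have mfHN := measurable_reflect 0 mfH.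
have mfNH : lebesgue_measurable (fun w => f (- w) * H w).
  exact: measurable_funM mfN mH.
rewrite -[RHS](Rintegral_reflect 0 mfH); congr fine.
apply: (@ae_eq_integral _ (lebesgue_rV R n) _ mu setT
  (fun w => (f (0 - w) * H (0 - w))%:E) (fun w => (f (- w) * H w)%:E)).
- exact: measurableT.
- by move/measurable_EFinP : mfNH.
- by move/measurable_EFinP : mfHN.
- apply: negligibleS Heven => w /= nE Hw; apply: nE => _.
  by rewrite sub0r -Hw.
Qed.

Lemma integrable_kernel_bounded f M : lebesgue_integrable setT H ->
  lebesgue_measurable f -> (forall w, `|f w| <= M) ->
  lebesgue_integrable setT (fun w => f w * H w).
Proof.
move=> iH mf fM; apply: le_lebesgue_integrable.
- exact: measurable_funM.
- exact: (integrableZl measurableT M (integrable_norm iH)).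
- by move=> w; rewrite /= normrM ler_wpM2r.
Qed.

End even_kernel.

(** Averaging the substitutions [y = x - w] and [y = x + w]: for an even kernel
    the first differences combine into second differences. *)
Lemma operator_second_diff H zeta x M : lebesgue_integrable setT H ->
  {ae mu, forall z, H z = H (- z)} -> continuous zeta ->
  (forall x, `|zeta x| <= M) ->
  \int[mu]_y ((zeta x - zeta y) * H (x - y)) =
  2^-1 * \int[mu]_w (second_diff zeta x w * H w).
Proof.
move=> iH Heven czeta zetaM.
have mH := integrable_measurable iH.
have mz : lebesgue_measurable zeta by exact: continuous_lebesgue_measurable.
have mzB : lebesgue_measurable (fun w => zeta x - zeta (x - w)).
  exact: (measurable_funB (measurable_cst _) (measurable_reflect x mz)).
have mzD : lebesgue_measurable (fun w => zeta x - zeta (x + w)).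
  exact: (measurable_funB (measurable_cst _) (measurable_translate x mz)).
have bz y : `|zeta x - zeta y| <= M + M.
  by rewrite (le_trans (ler_normB _ _))// lerD.
have mG : lebesgue_measurable (fun y => (zeta x - zeta y) * H (x - y)).
  apply: measurable_funM; last exact: measurable_reflect.
  exact: (measurable_funB (measurable_cst _) mz).
rewrite -(Rintegral_reflect x mG).
have EB : \int[mu]_y ((zeta x - zeta (x - y)) * H (x - (x - y))) =
    \int[mu]_w ((zeta x - zeta (x - w)) * H w).
  by apply: eq_Rintegral => w _; rewrite subKr.
have ED : \int[mu]_w ((zeta x - zeta (x - w)) * H w) =
    \int[mu]_w ((zeta x - zeta (x + w)) * H w).
  rewrite -(even_kernel_symmetry mH Heven mzB).
  by apply: eq_Rintegral => w _; rewrite opprK.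
have -> : \int[mu]_w (second_diff zeta x w * H w) =
    \int[mu]_w ((zeta x - zeta (x - w)) * H w) +
    \int[mu]_w ((zeta x - zeta (x + w)) * H w).
  rewrite -RintegralD//; last 2 first.
  - exact: (integrable_kernel_bounded mH iH mzB).
  - exact: (integrable_kernel_bounded mH iH mzD).
  by apply: eq_Rintegral => w _; rewrite /second_diff; ring.
by rewrite EB -ED; field.
Qed.

Section levy_kernel.
Variable K : 'rV[R]_n -> R.
Hypotheses (mK : lebesgue_measurable K) (K0 : forall z, 0 <= K z)
  (Keven : {ae mu, forall z, K z = K (- z)})
  (iK : lebesgue_integrable setT (fun w => enorm w ^+ 2 * K w)).

Lemma second_diff_kernel_measurable zeta x : continuous zeta ->
  lebesgue_measurable (fun w => second_diff zeta x w * K w).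
Proof.
move=> cz; apply: measurable_funM mK.
have mz : lebesgue_measurable zeta by exact: continuous_lebesgue_measurable.
apply: (measurable_funB _ (measurable_reflect x mz)).
exact: (measurable_funB (measurable_cst _) (measurable_translate x mz)).
Qed.

Lemma second_diff_kernel_le zeta C x w :
  `|second_diff zeta x w| <= C * `|w| ^+ 2 -> 0 <= C ->
  `|second_diff zeta x w * K w| <= C * (enorm w ^+ 2 * K w).
Proof.
move=> hC C0; rewrite normrM (ger0_norm (K0 w)) mulrA ler_wpM2r//.
apply: (le_trans hC); rewrite ler_wpM2l// lerXn2r ?nnegrE ?enorm_ge0//.
exact: norm_le_enorm.
Qed.

(** Integrals outside a ball are integrals over the whole space against this kernel,
    which is integrable even when [K] is singular at the origin. *)
Definition kernel_cut r w : R := K w * \1_[set w | r <= enorm w] w.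

Lemma measurable_kernel_cut r : lebesgue_measurable (kernel_cut r).
Proof.
apply: measurable_funM mK _; apply/measurable_indicP.
have := @measurable_enorm; rewrite /lebesgue_measurable => /(_ measurableT).
by move=> /(_ [set t | r <= t]); rewrite setTI; apply; rewrite -set_itvcy.
Qed.

Lemma kernel_cut_even r : {ae mu, forall z, kernel_cut r z = kernel_cut r (- z)}.
Proof.
apply: negligibleS Keven => w /= nE Kw; apply: nE.
by rewrite /kernel_cut -Kw !indicE; congr (_ * (_ : bool)%:R);
  apply/idP/idP; rewrite !in_setE/= enormN.
Qed.

Lemma integrable_kernel_cut r : 0 < r -> lebesgue_integrable setT (kernel_cut r).
Proof.
move=> r0; apply: (le_lebesgue_integrable (measurable_kernel_cut r)).
  exact: (integrableZl measurableT (r ^- 2) iK).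
move=> w; rewrite /kernel_cut normrM ger0_norm// indicE.
have [|] := boolP (w \in _); last first.
  rewrite normr0 mulr0 => _; apply: mulr_ge0.
    by rewrite invr_ge0 exprn_ge0// ltW.
  by rewrite mulr_ge0// sqr_ge0.
rewrite in_setE/= => rw; rewrite normr1 mulr1 mulrA ler_peMl//.
rewrite mulrC ler_pdivlMr ?exprn_gt0// mul1r lerXn2r// nnegrE; last exact: enorm_ge0.
exact: ltW.
Qed.

Lemma truncated_opE zeta x r M : continuous zeta -> (forall x, `|zeta x| <= M) ->
  0 < r ->
  truncated_op K zeta x r =
  2^-1 * \int[mu]_w (second_diff zeta x w * kernel_cut r w).
Proof.
move=> cz zM r0.
rewrite -(operator_second_diff x (integrable_kernel_cut r0) (kernel_cut_even r) cz zM).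
rewrite /truncated_op Rintegral_mkcond; apply: eq_Rintegral => y _.
rewrite patchE /kernel_cut indicE /integrand mulrA.
have -> : (x - y \in [set w | r <= enorm w]) = (y \in ~` eball x r).
  apply/idP/idP; rewrite !in_setE /= /eball /= -[x - y]opprB enormN.
    by rewrite leNgt => /negP.
  by move/negP; rewrite -leNgt.
by case: ifP => _; rewrite ?mulr1 ?mulr0.
Qed.

(** Second differences are dominated by [enorm w ^+ 2 * K w], so the truncation can
    be removed by dominated convergence. *)
Lemma truncated_op_cvg zeta x : test_function zeta ->
  truncated_op K zeta x r @[r --> 0^'+] -->
    2^-1 * \int[mu]_w (second_diff zeta x w * K w).
Proof.
move=> tz; have cz := smooth_continuous tz.1.
have [M M0 zM] := test_function_iter_bounded [::] tz.
have [C C0 hC] := test_function_second_diff tz.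
apply/cvg_at_rightP => r [r_gt0 r_cvg].
rewrite (_ : (fun k => _) = (fun k =>
  2^-1 * \int[mu]_w (second_diff zeta x w * kernel_cut (r k) w))); last first.
  by apply/funext => k; rewrite (truncated_opE x cz zM).
apply: cvgM; first exact: cvg_cst.
apply: (Rintegral_dominated_cvg (g := fun w => C * (enorm w ^+ 2 * K w))).
- move=> k; have mcut := measurable_kernel_cut (r k).
  rewrite (_ : (fun w => _) = (fun w => second_diff zeta x w * K w *
      \1_[set w | r k <= enorm w] w)).
    apply: measurable_funM (second_diff_kernel_measurable x cz) _.
    apply/measurable_indicP.
    have := @measurable_enorm; rewrite /lebesgue_measurable => /(_ measurableT).
    by move=> /(_ [set t | r k <= t]); rewrite setTI; apply; rewrite -set_itvcy.
  by apply/funext => w; rewrite /kernel_cut mulrA.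
- exact: second_diff_kernel_measurable.
- move=> w; have [->|w0] := eqVneq w 0.
    rewrite /second_diff subr0 addr0 (_ : 2 * _ - _ - _ = 0); last by ring.
    by under eq_fun do rewrite mul0r; rewrite mul0r; exact: cvg_cst.
  have ew : 0 < enorm w by rewrite (lt_le_trans _ (norm_le_enorm w))// normr_gt0.
  apply: cvg_near_cst.
  move/cvgrPdist_lt : r_cvg => /(_ _ ew); apply: filterS => k.
  rewrite sub0r normrN => rk; rewrite /kernel_cut indicE mem_set ?mulr1//=.
  by rewrite (le_trans (ler_norm _))// ltW.
- exact: (integrableZl measurableT C iK).
- move=> k w; apply: (le_trans _ (second_diff_kernel_le (hC x w) C0)).
  rewrite /kernel_cut !normrM ler_wpM2l// ler_piMr// indicE.
  by case: (_ \in _); rewrite ?normr1 ?normr0.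
Qed.

(** The two cases of the definition agree: for an integrable kernel this is
    [operator_second_diff], otherwise it is the limit of the truncations. *)
Lemma nonlocal_opE zeta x : test_function zeta ->
  nonlocal_op K zeta x = 2^-1 * \int[mu]_w (second_diff zeta x w * K w).
Proof.
move=> tz; have cz := smooth_continuous tz.1.
have [M M0 zM] := test_function_iter_bounded [::] tz.
rewrite /nonlocal_op; case: ifPn => [iK1|_]; first exact: operator_second_diff zM.
exact/cvg_lim/truncated_op_cvg.
Qed.

End levy_kernel.

End operator.

(** * Mollification of the linearized equation *)

Section borel_composition.
Context {R : realType} {n : nat} {d} {T : measurableType d}.
Implicit Types (f g : T -> 'rV[R]_n).

Lemma measurable_rVD f g : measurable_fun setT f -> measurable_fun setT g ->
  measurable_fun setT (fun t => f t + g t).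
Proof.
move=> mf mg; apply: measurable_fun_rV => i.
rewrite (_ : (fun t => _) = (fun t => f t 0 i + g t 0 i)); last first.
  by apply/funext => t; rewrite mxE.
by apply: measurable_funD; exact: (measurableT_comp (@measurable_rV_coor R n i)).
Qed.

Lemma measurable_rVB f g : measurable_fun setT f -> measurable_fun setT g ->
  measurable_fun setT (fun t => f t - g t).
Proof.
move=> mf mg; apply: measurable_fun_rV => i.
rewrite (_ : (fun t => _) = (fun t => f t 0 i - g t 0 i)); last first.
  by apply/funext => t; rewrite !mxE.
by apply: measurable_funB; exact: (measurableT_comp (@measurable_rV_coor R n i)).
Qed.

Lemma measurable_second_diff (u : 'rV[R]_n -> R) f g : measurable_fun setT u ->
  measurable_fun setT f -> measurable_fun setT g ->
  measurable_fun setT (fun t => second_diff u (f t) (g t)).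
Proof.
move=> mu mf mg; apply: measurable_funB; last first.
  exact: (measurableT_comp mu (measurable_rVB mf mg)).
apply: measurable_funB; last exact: (measurableT_comp mu (measurable_rVD mf mg)).
exact: (measurable_funM (measurable_cst _) (measurableT_comp mu mf)).
Qed.

End borel_composition.

Section lebesgue_product.
Context {R : realType} {n : nat}.
Implicit Types (f g : 'rV[R]_n -> R) (x y z w : 'rV[R]_n).
Local Notation mu := (@lebesgue_vol R n).

Lemma lebesgue_fubini (F : 'rV[R]_n -> 'rV[R]_n -> R) f g :
  measurable_fun setT (fun p : lebesgue_rV R n * lebesgue_rV R n => F p.1 p.2) ->
  lebesgue_integrable setT f -> lebesgue_integrable setT g ->
  (forall x y, `|F x y| <= f x * g y) ->
  [/\ forall x, lebesgue_integrable setT (F x),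
      forall y, lebesgue_integrable setT (F ^~ y),
      lebesgue_integrable setT (fun x => \int[mu]_y F x y),
      lebesgue_integrable setT (fun y => \int[mu]_x F x y) &
      \int[mu]_x \int[mu]_y F x y = \int[mu]_y \int[mu]_x F x y].
Proof.
move=> mF If Ig Ffg.
have mF' : measurable_fun setT
    (fun p : lebesgue_rV R n * lebesgue_rV R n => F p.2 p.1).
  exact: (measurableT_comp mF (@measurable_swap _ _ _ _)).
have Fgf y x : `|F x y| <= g y * f x by rewrite mulrC.
split.
- exact: (dominated_integrable_section mF Ig Ffg).
- move=> y; have := @dominated_integrable_section _ _ (lebesgue_rV R n)
    (lebesgue_rV R n) R mu (fun y x => F x y) g f mF' If Fgf y.
  by [].
- exact: (dominated_integrable_Rintegral mF If Ig Ffg).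
- have := @dominated_integrable_Rintegral _ _ (lebesgue_rV R n) (lebesgue_rV R n)
    R mu mu (fun y x => F x y) g f mF' Ig If Fgf.
  by [].
- exact: (dominated_fubini mF If Ig Ffg).
Qed.

Lemma measurable_fst_rV : measurable_fun setT
  (fun p : lebesgue_rV R n * lebesgue_rV R n => p.1 : 'rV[R]_n).
Proof. exact: (measurableT_comp measurable_lebesgue_id measurable_fst). Qed.

Lemma measurable_snd_rV : measurable_fun setT
  (fun p : lebesgue_rV R n * lebesgue_rV R n => p.2 : 'rV[R]_n).
Proof. exact: (measurableT_comp measurable_lebesgue_id measurable_snd). Qed.

Lemma borel_lebesgue_measurable f : measurable_fun setT f -> lebesgue_measurable f.
Proof. by move=> mf; exact: (measurableT_comp mf measurable_lebesgue_id). Qed.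

(** Test functions are Lipschitz, which takes care of the singularity of [K], and
    the supports of [xi] and [K] confine [z]: the integrand has a product bound. *)
Lemma increment_fubini (K : 'rV[R]_n -> R) (R0 : R) (xi : 'rV[R]_n -> R) (rho : R) :
  lebesgue_measurable K -> (forall z, 0 <= K z) ->
  lebesgue_integrable setT (fun w => enorm w ^+ 2 * K w) ->
  (forall w, R0 <= enorm w -> K w = 0) ->
  test_function xi -> (forall x, rho <= `|x| -> xi x = 0) ->
  [/\ forall z, lebesgue_integrable setT (fun w => (xi z - xi (z + w)) ^+ 2 * K w),
      forall w, lebesgue_integrable setT (fun z => (xi z - xi (z + w)) ^+ 2 * K w),
      lebesgue_integrable setT
        (fun z => \int[mu]_w ((xi z - xi (z + w)) ^+ 2 * K w)),
      lebesgue_integrable setT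
        (fun w => \int[mu]_z ((xi z - xi (z + w)) ^+ 2 * K w)) &
      \int[mu]_z \int[mu]_w ((xi z - xi (z + w)) ^+ 2 * K w) =
      \int[mu]_w \int[mu]_z ((xi z - xi (z + w)) ^+ 2 * K w)].
Proof.
move=> mK K0 iK K_supp txi xi_supp.
have mxi : measurable_fun setT xi.
  exact: continuous_measurable_rV (smooth_continuous txi.1).
pose F z w := (xi z - xi (z + w)) ^+ 2 * K w.
have [L L0 hL] := test_function_lipschitz txi.
have mF : measurable_fun setT
    (fun p : lebesgue_rV R n * lebesgue_rV R n => F p.1 p.2).
  apply: measurable_funM; last exact: (measurableT_comp mK measurable_snd).
  apply: measurable_funX; apply: measurable_funB.
    exact: (measurableT_comp mxi measurable_fst_rV).
  exact: (measurableT_comp mxi (measurable_rVD measurable_fst_rV measurable_snd_rV)).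
have Fle z w : `|F z w| <=
    (L ^+ 2 * \1_[set x : 'rV[R]_n | `|x| <= rho + R0] z) * (enorm w ^+ 2 * K w).
  have b0 : 0 <= enorm w ^+ 2 * K w by rewrite mulr_ge0 ?sqr_ge0.
  have c0 : 0 <= L ^+ 2 * \1_[set x : 'rV[R]_n | `|x| <= rho + R0] z.
    by rewrite mulr_ge0 ?sqr_ge0// indicE ler0n.
  have [wR|wR] := leP R0 (enorm w).
    by rewrite /F (K_supp w wR) !mulr0 normr0.
  have [zr|zr] := leP `|z| (rho + R0).
    rewrite indicE mem_set// mulr1 /F normrM (ger0_norm (K0 w)) mulrA.
    apply: (ler_wpM2r (K0 w)).
    have hLw : `|xi z - xi (z + w)| <= L * enorm w.
      rewrite -normrN opprB; apply: (le_trans (hL z w)).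
      exact: (ler_wpM2l L0 (norm_le_enorm w)).
    rewrite normrX -exprMn; apply: lerXn2r; rewrite ?nnegrE.
    - exact: normr_ge0.
    - exact: (mulr_ge0 L0 (enorm_ge0 w)).
    - exact: hLw.
  have wn := norm_le_enorm w; have w0 := normr_ge0 w.
  have z1 : rho <= `|z| by lra.
  have z2 : rho <= `|z + w|.
    by have := lerB_dist z (- w); rewrite opprK normrN; lra.
  rewrite /F (xi_supp _ z1) (xi_supp _ z2) subrr expr0n mul0r normr0.
  exact: (mulr_ge0 c0 b0).
exact: lebesgue_fubini mF (@integrableZ_cube R n _ _) iK Fle.
Qed.

End lebesgue_product.

Section mollification.
Context {R : realType} {n : nat}.
Implicit Types (f g : 'rV[R]_n -> R) (x y z w : 'rV[R]_n) (a r t M : R).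
Local Notation mu := (@lebesgue_vol R n).

Variables (phi eta : 'rV[R]_n -> R) (r : R).
Hypotheses (cphi : continuous phi) (phi_gt0 : forall x, 0 < phi x)
  (teta : test_function eta) (eta_ge0 : forall x, 0 <= eta x)
  (r_gt0 : 0 < r) (eta_supp : forall x, r <= `|x| -> eta x = 0).

Let ceta : continuous eta := smooth_continuous teta.1.
Let mphi : measurable_fun setT phi := continuous_measurable_rV cphi.
Let meta : measurable_fun setT eta := continuous_measurable_rV ceta.

Lemma mollifier_supp x z : `|z| + r <= `|x| -> eta (z - x) = 0.
Proof.
by move=> zx; apply: eta_supp; have := lerB_dist x z; rewrite distrC; lra.
Qed.

Lemma mollifier_test z : test_function (fun x => eta (z - x)).
Proof.
have [seta _] := teta; apply/test_functionP; split.
  rewrite (_ : (fun x => _) = (fun x => eta (-1 *: x + z))).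
    exact: smooth_affine.
  by apply/funext => x; rewrite scaleN1r addrC.
exists (`|z| + r) => [|x]; first by rewrite ltr_wpDl.
exact: mollifier_supp.
Qed.

Lemma mollifier_second_diff z x w :
  second_diff (fun x => eta (z - x)) x w = second_diff eta (z - x) w.
Proof.
rewrite /second_diff (_ : z - (x + w) = z - x - w); last by rewrite opprD addrA.
rewrite (_ : z - (x - w) = z - x + w); last by rewrite opprD opprK addrA.
by rewrite addrAC.
Qed.

Lemma mollifier_second_diff_supp x z w : `|z| + r + `|w| <= `|x| ->
  second_diff eta (z - x) w = 0.
Proof.
move=> xs.
have e0 y : `|y| <= `|w| -> eta (z - x + y) = 0.
  move=> yw; apply: eta_supp.
  have := lerB_dist (x - z) y; have := lerB_dist x z.
  by rewrite -[z - x + y]opprK normrN opprD opprB; lra.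
have e1 := e0 w (lexx _).
have e2 : eta (z - x - w) = 0 by apply: e0; rewrite normrN.
have e3 : eta (z - x) = 0 by rewrite -[z - x]addr0; apply: e0; rewrite normr0.
by rewrite /second_diff e1 e2 e3 mulr0 !subr0.
Qed.

Lemma phi_bounded t : exists2 M : R, 0 <= M & forall x, `|x| <= t -> phi x <= M.
Proof.
have [M M0 hM] := continuous_bounded_ball t cphi; exists M => // x /hM.
exact/le_trans/ler_norm.
Qed.

Lemma phi_bounded_below t : exists2 m : R, 0 < m & forall x, `|x| <= t -> m <= phi x.
Proof.
have ciphi : continuous (fun x => (phi x)^-1).
  by move=> x; apply: (@continuousV _ _ phi x (lt0r_neq0 (phi_gt0 x))); exact: cphi.
have [M M0 hM] := continuous_bounded_ball t ciphi.
exists (M + 1)^-1; first by rewrite invr_gt0 ltr_wpDl.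
move=> x /hM h; have p0 := phi_gt0 x.
have {}h : 1 <= M * phi x.
  by rewrite -ler_pdivrMr// mul1r (le_trans (ler_norm _)).
have M1 : 0 < M + 1 by rewrite ltr_wpDl.
by rewrite -[leLHS]mul1r ler_pdivrMr//; lra.
Qed.

Definition mollify z := \int[mu]_x (phi x * eta (z - x)).

Lemma mollify_integrable (h : 'rV[R]_n -> R) z M : lebesgue_measurable h ->
  (forall x, `|h x| <= M) ->
  lebesgue_integrable setT (fun x => h x * phi x * eta (z - x)).
Proof.
move=> mh hM.
have [P P0 hP] := phi_bounded (`|z| + r).
have [E E0 hE] := test_function_iter_bounded [::] teta.
apply: (@integrable_bounded_support _ _ _ (M * P * E) (`|z| + r)).
- apply: measurable_funM.
    exact: (measurable_funM mh (borel_lebesgue_measurable mphi)).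
  exact: (measurable_reflect _ (borel_lebesgue_measurable meta)).
- move=> x xz; rewrite !normrM.
  apply: ler_pM; [exact: mulr_ge0|exact: normr_ge0| |exact: (hE (z - x))].
  by apply: ler_pM => //; rewrite gtr0_norm ?hP.
- by move=> x /ltW xz; rewrite mollifier_supp ?mulr0.
Qed.

Lemma mollify_integrable1 z :
  lebesgue_integrable setT (fun x => phi x * eta (z - x)).
Proof.
have := @mollify_integrable (fun=> 1) z 1 (measurable_cst _) _.
by under [X in lebesgue_integrable _ X]eq_fun do rewrite mul1r; apply=> x;
  rewrite normr1.
Qed.

(** The convolution is Borel, not merely Lebesgue measurable, so that it may be
    composed with sums of variables on product spaces. *)
Lemma measurable_mollify : measurable_fun setT mollify.
Proof.
have mF : measurable_fun setT
    (fun p : 'rV[R]_n * lebesgue_rV R n => (phi p.2 * eta (p.1 - p.2))%:E).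
  apply/measurable_EFinP/measurable_funM.
    by apply: (measurableT_comp mphi);
      exact: (measurableT_comp measurable_lebesgue_id measurable_snd).
  apply: (measurableT_comp meta); apply: measurable_rVB; first exact: measurable_fst.
  exact: (measurableT_comp measurable_lebesgue_id measurable_snd).
apply: (measurableT_comp (fine_measurable measurableT)).
apply: (measurable_fun_fubini_tonelli_F
  (fun p : 'rV[R]_n * lebesgue_rV R n => (phi p.2 * eta (p.1 - p.2))%:E)) => //.
by move=> p; rewrite lee_fin mulr_ge0// ltW.
Qed.

Definition mass := \int[mu]_x eta x.

Lemma eta_integrable : lebesgue_integrable setT eta.
Proof.
have [E E0 hE] := test_function_iter_bounded [::] teta.
apply: (@integrable_bounded_support _ _ _ E r).
- exact: borel_lebesgue_measurable.
- by move=> x _; exact: (hE x).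
- by move=> x /ltW /eta_supp.
Qed.

Lemma mass_reflect z : \int[mu]_x eta (z - x) = mass.
Proof. exact: (Rintegral_reflect z (borel_lebesgue_measurable meta)). Qed.

Lemma mass_translate x : \int[mu]_z eta (z - x) = mass.
Proof. exact: (Rintegral_translate (- x) (borel_lebesgue_measurable meta)). Qed.

(** The convolution is a weighted mean of [phi] near [z], of total weight [mass]. *)
Lemma mollify_bounds z M m :
  (forall x, `|x - z| <= r -> m <= phi x) -> (forall x, `|x - z| <= r -> phi x <= M) ->
  m * mass <= mollify z <= M * mass.
Proof.
move=> hm hM; have ieta := integrable_reflect z eta_integrable.
rewrite -(mass_reflect z) -!RintegralZl//.
have cmp x : m * eta (z - x) <= phi x * eta (z - x) <= M * eta (z - x).
  have [xz|xz] := leP `|x - z| r; first by rewrite !ler_wpM2r ?hm ?hM.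
  by rewrite eta_supp ?mulr0 ?lexx// distrC ltW.
apply/andP; split; apply: le_Rintegral => //.
- exact: (integrableZl measurableT m ieta).
- exact: mollify_integrable1.
- by move=> x _; case/andP: (cmp x).
- exact: mollify_integrable1.
- exact: (integrableZl measurableT M ieta).
- by move=> x _; case/andP: (cmp x).
Qed.

Lemma mollify_second_diff_integrable z w :
  lebesgue_integrable setT (fun x => phi x * second_diff eta (z - x) w).
Proof.
have [C C0 hC] := test_function_second_diff teta.
have [P P0 hP] := phi_bounded (`|z| + r + `|w|).
apply: (@integrable_bounded_support _ _ _ (P * (C * `|w| ^+ 2)) (`|z| + r + `|w|)).
- apply: measurable_funM; first exact: borel_lebesgue_measurable mphi.
  apply: measurable_second_diff; [exact: meta| |exact: measurable_cst].
  exact: (measurable_rVB (measurable_cst _) measurable_lebesgue_id).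
- move=> x xz; rewrite normrM (gtr0_norm (phi_gt0 x)).
  by rewrite ler_pM ?(ltW (phi_gt0 x)) ?(hP x xz) ?(hC (z - x) w) ?normr_ge0.
- by move=> x /ltW xz; rewrite mollifier_second_diff_supp ?mulr0.
Qed.

Lemma mollify_second_diff z w :
  \int[mu]_x (phi x * second_diff eta (z - x) w) = second_diff mollify z w.
Proof.
have i1 := mollify_integrable1 z.
have i0 := lebesgue_integrableZ 2 i1.
have ip := mollify_integrable1 (z + w).
have im := mollify_integrable1 (z - w).
rewrite {2}/second_diff /mollify -(lebesgue_integralZ 2 i1).
rewrite -(lebesgue_integralB i0 ip) -(lebesgue_integralB (lebesgue_integrableB i0 ip) im).
apply: lebesgue_integral_ext => x.
by rewrite /second_diff (addrAC z (- x) w) (addrAC z (- x) (- w)); ring.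
Qed.

Section mollified_equation.
Variables (K : 'rV[R]_n -> R) (R0 : R).
Hypotheses (mK : lebesgue_measurable K) (K0 : forall z, 0 <= K z)
  (Keven : {ae mu, forall z, K z = K (- z)})
  (iK : lebesgue_integrable setT (fun w => enorm w ^+ 2 * K w))
  (K_supp : forall w, R0 <= enorm w -> K w = 0).

(** The bound is uniform for [z] in a ball: this is what allows the integrals in
    [x], [w] and, later, [z] to be exchanged. *)
Lemma mollifier_kernel_le rho : exists2 M : R, 0 <= M &
  forall z, `|z| <= rho -> forall x w,
    `|phi x * (second_diff eta (z - x) w * K w)| <=
    (M * \1_[set x : 'rV[R]_n | `|x| <= rho + r + R0] x) * (enorm w ^+ 2 * K w).
Proof.
have [P P0 hP] := phi_bounded (rho + r + R0).
have [C C0 hC] := test_function_second_diff teta.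
exists (P * C) => [|z zrho x w]; first exact: mulr_ge0.
have b0 : 0 <= enorm w ^+ 2 * K w by rewrite mulr_ge0 ?sqr_ge0.
have [wR|wR] := leP R0 (enorm w); first by rewrite K_supp// !mulr0 normr0.
rewrite indicE; have [xs|xs] := leP `|x| (rho + r + R0).
  rewrite mem_set// mulr1 normrM -mulrA; apply: ler_pM => //.
    by rewrite gtr0_norm// hP.
  exact: second_diff_kernel_le.
rewrite mollifier_second_diff_supp; last by have := norm_le_enorm w; lra.
rewrite mul0r mulr0 normr0; apply: mulr_ge0 => //.
by apply: mulr_ge0; rewrite ?mulr_ge0 ?ler0n.
Qed.

(** The weak equation tested with [fun x => eta (z - x)], the second difference
    being moved onto [phi] by Fubini's theorem. *)
Lemma mollified_equation V : weak_solution K V phi -> forall z,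
  2^-1 * \int[mu]_w (second_diff mollify z w * K w) =
  \int[mu]_x (V x * phi x * eta (z - x)).
Proof.
move=> weak z; have := weak _ (mollifier_test z).
move/(congr1 fine); rewrite -!/(Rintegral _ _ _) => <-.
have [M M0 hM] := mollifier_kernel_le `|z|.
have [C C0 hC] := test_function_second_diff teta.
pose F x w := phi x * (second_diff eta (z - x) w * K w).
have mF : measurable_fun setT (fun p : lebesgue_rV R n * lebesgue_rV R n => F p.1 p.2).
  apply: measurable_funM; first exact: (measurableT_comp mphi measurable_fst_rV).
  apply: measurable_funM; last exact: (measurableT_comp mK measurable_snd).
  apply: measurable_second_diff; [exact: meta| |exact: measurable_snd_rV].
  exact: (measurable_rVB (measurable_cst _) measurable_fst_rV).
have ia := @integrableZ_cube R n M (`|z| + r + R0).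
have hF := hM z (lexx _).
have iD x : lebesgue_integrable setT (fun w => second_diff eta (z - x) w * K w).
  apply: (le_lebesgue_integrable _ (lebesgue_integrableZ C iK)).
    exact: second_diff_kernel_measurable mK _ _ ceta.
  by move=> w; exact: second_diff_kernel_le.
have [_ _ iF _ FE] := lebesgue_fubini mF ia iK hF.
have -> : \int[mu]_x (phi x * nonlocal_op K (fun x => eta (z - x)) x) =
    \int[mu]_x (2^-1 * \int[mu]_w F x w).
  apply: lebesgue_integral_ext => x.
  rewrite (nonlocal_opE mK K0 Keven iK _ (mollifier_test z)).
  rewrite mulrCA; congr (_ * _); rewrite /F (lebesgue_integralZ _ (iD x)).
  congr (_ * _); apply: lebesgue_integral_ext => w.
  by rewrite mollifier_second_diff.
rewrite (lebesgue_integralZ _ iF) FE; congr (_ * _).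
apply: lebesgue_integral_ext => w.
rewrite -mollify_second_diff mulrC -lebesgue_integralZ.
  by apply: lebesgue_integral_ext => x; rewrite /F; ring.
exact: mollify_second_diff_integrable.
Qed.

Section energy.
Variables (xi : 'rV[R]_n -> R) (rho : R).
Hypotheses (txi : test_function xi) (xi_supp : forall x, rho <= `|x| -> xi x = 0)
  (mass_gt0 : 0 < mass).

Let cxi : continuous xi := smooth_continuous txi.1.
Let mxi : measurable_fun setT xi := continuous_measurable_rV cxi.

Lemma mollify_ge t : exists2 m : R, 0 < m & forall z, `|z| <= t -> m * mass <= mollify z.
Proof.
have [m m0 hm] := phi_bounded_below (t + r).
have [M _ hM] := phi_bounded (t + r).
exists m => // z zt; have le x : `|x - z| <= r -> `|x| <= t + r.
  by move=> xz; have := ler_normD (x - z) z; rewrite subrK; lra.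
by have /andP[] := @mollify_bounds z M m (fun x h => hm _ (le x h))
  (fun x h => hM _ (le x h)).
Qed.

Lemma mollify_gt0 z : 0 < mollify z.
Proof.
have [m m0 hm] := mollify_ge `|z|.
by apply: lt_le_trans (hm z (lexx _)); exact: mulr_gt0.
Qed.

Lemma mollify_le t : exists2 M : R, 0 <= M & forall z, `|z| <= t -> `|mollify z| <= M.
Proof.
have [M M0 hM] := phi_bounded (t + r).
exists (M * mass) => [|z zt]; first by rewrite mulr_ge0// ltW.
have le x : `|x - z| <= r -> `|x| <= t + r.
  by move=> xz; have := ler_normD (x - z) z; rewrite subrK; lra.
rewrite gtr0_norm ?mollify_gt0//.
by have /andP[] := @mollify_bounds z M 0 (fun x _ => ltW (phi_gt0 x))
  (fun x h => hM _ (le x h)).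
Qed.

(** The formal test function [xi ^+ 2 / phi], with [phi] mollified; it multiplies
    the mollified equation. *)
Definition quotient z := xi z ^+ 2 / mollify z.

Lemma measurable_quotient : measurable_fun setT quotient.
Proof.
rewrite (_ : quotient = (fun z => xi z ^+ 2 * mollify z `^ (-1))); last first.
  by apply/funext => z; rewrite powR_inv1// ltW// mollify_gt0.
apply: measurable_funM; first exact: measurable_funX.
exact: (measurableT_comp (measurable_powR (-1)) measurable_mollify).
Qed.

Lemma quotient_supp z : rho <= `|z| -> quotient z = 0.
Proof. by move=> /xi_supp; rewrite /quotient => ->; rewrite expr0n mul0r. Qed.

Lemma quotient_bounded : exists2 G : R, 0 <= G & forall z, `|quotient z| <= G.
Proof.
have [m m0 hm] := mollify_ge rho.
have [X X0 hX] := test_function_iter_bounded [::] txi.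
have mm : 0 < m * mass by exact: mulr_gt0.
exists (X ^+ 2 / (m * mass)) => [|z]; first by rewrite divr_ge0// ?sqr_ge0// ltW.
have [zr|/ltW zr] := leP `|z| rho; last first.
  by rewrite quotient_supp// normr0 divr_ge0// ?sqr_ge0// ltW.
rewrite /quotient normrM normfV normrX (gtr0_norm (mollify_gt0 z)).
apply: ler_pM; rewrite ?exprn_ge0 ?invr_ge0 ?(ltW (mollify_gt0 z))//.
  by rewrite lerXn2r ?nnegrE//; exact: (hX z).
by rewrite lef_pV2 ?posrE ?mollify_gt0// hm.
Qed.

Lemma quotient_integrable f P : lebesgue_measurable f ->
  (forall z, `|z| <= rho -> `|f z| <= P) ->
  lebesgue_integrable setT (fun z => quotient z * f z).
Proof.
move=> mf hP; have [G G0 hG] := quotient_bounded.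
apply: (@integrable_bounded_support _ _ _ (G * P) rho).
- exact: measurable_funM (borel_lebesgue_measurable measurable_quotient) mf.
- by move=> x xr; rewrite normrM ler_pM// hP.
- by move=> x /ltW xr; rewrite quotient_supp ?mul0r.
Qed.

Lemma picone (p q a b : R) : 0 < a -> 0 < b ->
  (p ^+ 2 / a - q ^+ 2 / b) * (a - b) <= (p - q) ^+ 2.
Proof.
move=> a0 b0; rewrite -subr_ge0.
have -> : (p - q) ^+ 2 - (p ^+ 2 / a - q ^+ 2 / b) * (a - b) =
    (p * b - q * a) ^+ 2 / (a * b) by field; rewrite !gt_eqF.
by rewrite divr_ge0 ?sqr_ge0// mulr_ge0 ?ltW.
Qed.

Lemma increment_integrable w :
  lebesgue_integrable setT (fun z => (xi z - xi (z + w)) ^+ 2).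
Proof.
have [X X0 hX] := test_function_iter_bounded [::] txi.
apply: (@integrable_bounded_support _ _ _ ((X + X) ^+ 2) (rho + `|w|)).
- apply: measurable_funX; apply: measurable_funB.
    exact: borel_lebesgue_measurable.
  by have := measurable_translate w (borel_lebesgue_measurable mxi);
    under eq_fun do rewrite addrC.
- move=> z _; rewrite normrX lerXn2r ?nnegrE ?addr_ge0//.
  by rewrite (le_trans (ler_normB _ _))// (lerD (hX z) (hX (z + w))).
- move=> z zw; have w0 := normr_ge0 w.
  have zr : rho <= `|z| by lra.
  have zwr : rho <= `|z + w|.
    by have := lerB_dist z (- w); rewrite opprK normrN; lra.
  by rewrite (xi_supp zr) (xi_supp zwr) subrr expr0n.
Qed.

(** Summation by parts in the translation variable, followed by the pointwise
    inequality of Picone. *)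
Lemma quotient_second_diff_le w :
  \int[mu]_z (quotient z * second_diff mollify z w) <=
  \int[mu]_z (xi z - xi (z + w)) ^+ 2.
Proof.
have mm := borel_lebesgue_measurable measurable_mollify.
have mmD y : lebesgue_measurable (fun z => mollify (z + y)).
  by have := measurable_translate y mm; under eq_fun do rewrite addrC.
have [P P0 hP] := mollify_le (rho + `|w|).
have w0 := normr_ge0 w.
have i1 : lebesgue_integrable setT (fun z => quotient z * mollify z).
  by apply: (quotient_integrable (P := P) mm) => z zr; apply: hP; lra.
have i2 : lebesgue_integrable setT (fun z => quotient z * mollify (z + w)).
  apply: (quotient_integrable (P := P) (mmD w)) => z zr; apply: hP.
  by have := ler_normD z w; lra.
have i3 : lebesgue_integrable setT (fun z => quotient z * mollify (z - w)).
  apply: (quotient_integrable (P := P) (mmD (- w))) => z zr; apply: hP.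
  by have := ler_normB z w; lra.
have j1 := integrable_translate w i1.
have j3 := integrable_translate w i3.
have E1 := Rintegral_translate w (integrable_measurable i1).
have E3 := Rintegral_translate w (integrable_measurable i3).
have i12 := lebesgue_integrableB i1 i2.
have i13 := lebesgue_integrableB i1 i3.
have j13 := lebesgue_integrableB j1 j3.
have -> : \int[mu]_z (quotient z * second_diff mollify z w) =
    \int[mu]_z (quotient z * mollify z - quotient z * mollify (z + w)) +
    \int[mu]_z (quotient z * mollify z - quotient z * mollify (z - w)).
  rewrite -(lebesgue_integralD i12 i13).
  by apply: lebesgue_integral_ext => z; rewrite /second_diff; ring.
rewrite (lebesgue_integralB i1 i3) -E1 -E3 -(lebesgue_integralB j1 j3).
rewrite -(lebesgue_integralD i12 j13).
apply: (lebesgue_le_integral (lebesgue_integrableD i12 j13) (increment_integrable w)).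
move=> z; rewrite addrK.
apply: le_trans (picone (xi z) (xi (z + w)) (mollify_gt0 z) (mollify_gt0 (z + w))).
rewrite -/(quotient z) -/(quotient (z + w)) le_eqVlt; apply/orP; left; apply/eqP.
by move: (quotient z) (quotient (z + w)) (mollify z) (mollify (z + w)) => *; ring.
Qed.

Lemma mollify_second_diff_kernel_le t : exists2 N : R, 0 <= N & forall z, `|z| <= t ->
  forall w, `|second_diff mollify z w * K w| <= N * (enorm w ^+ 2 * K w).
Proof.
have [M M0 hM] := mollifier_kernel_le t.
pose c x : R := M * \1_[set x : 'rV[R]_n | `|x| <= t + r + R0] x.
have ic : lebesgue_integrable setT c := @integrableZ_cube R n M (t + r + R0).
have c0 x : 0 <= c x by rewrite mulr_ge0// indicE ler0n.
exists (\int[mu]_x c x) => [|z zt w]; first exact: Rintegral_ge0.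
pose b := enorm w ^+ 2 * K w.
have mF : lebesgue_measurable (fun x => phi x * (second_diff eta (z - x) w * K w)).
  apply: measurable_funM; first exact: borel_lebesgue_measurable mphi.
  apply: measurable_funM; last exact: measurable_cst.
  apply: measurable_second_diff; [exact: meta| |exact: measurable_cst].
  exact: (measurable_rVB (measurable_cst _) measurable_lebesgue_id).
have icb := lebesgue_integrableZ b ic.
have iF : lebesgue_integrable setT
    (fun x => phi x * (second_diff eta (z - x) w * K w)).
  by apply: (le_lebesgue_integrable mF icb) => x; rewrite [leRHS]mulrC hM.
have -> : second_diff mollify z w * K w =
    \int[mu]_x (phi x * (second_diff eta (z - x) w * K w)).
  rewrite -mollify_second_diff mulrC -lebesgue_integralZ.
    by apply: lebesgue_integral_ext => x; ring.
  exact: mollify_second_diff_integrable.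
apply: (le_trans (le_normr_Rintegral measurableT iF)).
rewrite [leRHS]mulrC -(lebesgue_integralZ b ic).
apply: (lebesgue_le_integral (integrable_norm iF) icb) => x.
by rewrite [leRHS]mulrC; exact: hM.
Qed.

Lemma quotient_second_diff_integrable w :
  lebesgue_integrable setT (fun z => quotient z * second_diff mollify z w).
Proof.
have [P3 P30 hP3] := mollify_le (rho + `|w|).
apply: (quotient_integrable (P := 2 * P3 + P3 + P3)).
  exact: (measurable_second_diff measurable_mollify measurable_lebesgue_id
    (measurable_cst w)).
move=> z zr; have w0 := normr_ge0 w.
have a1 : `|mollify z| <= P3 by apply: hP3; lra.
have a2 : `|mollify (z + w)| <= P3.
  by apply: hP3; have := ler_normD z w; lra.
have a3 : `|mollify (z - w)| <= P3.
  by apply: hP3; have := ler_normB z w; lra.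
have a4 : `|2 * mollify z| <= 2 * P3 by rewrite normrM ger0_norm// ler_pM2l.
apply: (le_trans (ler_normB _ _)); apply: lerD a3.
by apply: (le_trans (ler_normB _ _)); exact: (lerD a4 a2).
Qed.

(** Moving the mollifier from [V * phi] onto [quotient] leaves this average, which
    is invariant under the multiplication of [eta] by a constant. *)
Definition average x := \int[mu]_z (quotient z * eta (z - x)).

Lemma average_integrand x : lebesgue_integrable setT (fun z => quotient z * eta (z - x)).
Proof.
have [E E0 hE] := test_function_iter_bounded [::] teta.
have me : lebesgue_measurable (fun z => eta (z - x)).
  by have := measurable_translate (- x) (borel_lebesgue_measurable meta);
    under eq_fun do rewrite addrC.
by apply: (quotient_integrable (P := E) me) => z _; exact: (hE (z - x)).
Qed.

(** The mollified equation is multiplied by [quotient z] and integrated in [z]; on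
    the left, the integrals in [z] and [w] are exchanged so that
    [quotient_second_diff_le] applies for each increment [w]. *)
Lemma energy_le V N : lebesgue_measurable V -> (forall x, `|V x| <= N) ->
  weak_solution K V phi ->
  \int[mu]_x (V x * phi x * average x) <=
  2^-1 * \int[mu]_z \int[mu]_w ((xi z - xi (z + w)) ^+ 2 * K w).
Proof.
move=> mV hN weak.
have [G G0 hG] := quotient_bounded.
have N0 : 0 <= N by rewrite (le_trans _ (hN 0)).
pose cube t : 'rV[R]_n -> R := \1_[set x : 'rV[R]_n | `|x| <= t].
have icube c t : lebesgue_integrable setT (fun x => c * cube t x).
  exact: (@integrableZ_cube R n c t).
have cube0 c t x : 0 <= c -> 0 <= c * cube t x.
  by move=> c0; rewrite mulr_ge0// /cube indicE ler0n.
have cube1 c t x : `|x| <= t -> c * cube t x = c.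
  by move=> xt; rewrite /cube indicE mem_set// mulr1.
have mq := measurable_quotient.
have mm := measurable_mollify.
have [P P0 hP] := phi_bounded (rho + r).
have [E E0 hE] := test_function_iter_bounded [::] teta.
pose F1 z x := quotient z * (V x * phi x * eta (z - x)).
have mF1 : measurable_fun setT
    (fun p : lebesgue_rV R n * lebesgue_rV R n => F1 p.1 p.2).
  apply: measurable_funM; first exact: (measurableT_comp mq measurable_fst_rV).
  apply: measurable_funM; last exact: (measurableT_comp meta
    (measurable_rVB measurable_fst_rV measurable_snd_rV)).
  apply: measurable_funM; last exact: (measurableT_comp mphi measurable_snd_rV).
  exact: (measurableT_comp mV measurable_snd).
have F1le z x : `|F1 z x| <= (G * cube rho z) * (N * P * E * cube (rho + r) x).
  have c1 := cube0 G rho z G0.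
  have c2 := cube0 (N * P * E) (rho + r) x (mulr_ge0 (mulr_ge0 N0 P0) E0).
  have [zr|zr] := leP rho `|z|.
    by rewrite /F1 (quotient_supp zr) mul0r normr0; exact: mulr_ge0.
  have [xr|xr] := leP `|x| (rho + r); last first.
    by rewrite /F1 mollifier_supp ?mulr0 ?normr0 ?mulr_ge0//; lra.
  rewrite !cube1// ?(ltW zr)// normrM; apply: ler_pM; rewrite ?normr_ge0 ?hG//.
  rewrite !normrM.
  apply: ler_pM; [exact: mulr_ge0|exact: normr_ge0| |exact: (hE (z - x))].
  by apply: ler_pM; rewrite ?normr_ge0 ?hN// (gtr0_norm (phi_gt0 x)) hP.
pose F2 z w := quotient z * (second_diff mollify z w * K w).
have [N2 N20 hN2] := mollify_second_diff_kernel_le rho.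
have mF2 : measurable_fun setT
    (fun p : lebesgue_rV R n * lebesgue_rV R n => F2 p.1 p.2).
  apply: measurable_funM; first exact: (measurableT_comp mq measurable_fst_rV).
  apply: measurable_funM; last exact: (measurableT_comp mK measurable_snd).
  exact: (measurable_second_diff mm measurable_fst_rV measurable_snd_rV).
have F2le z w : `|F2 z w| <= (G * N2 * cube rho z) * (enorm w ^+ 2 * K w).
  have b0 : 0 <= enorm w ^+ 2 * K w by rewrite mulr_ge0 ?sqr_ge0.
  have [zr|/ltW zr] := leP rho `|z|.
    rewrite /F2 (quotient_supp zr) mul0r normr0; apply: mulr_ge0 b0.
    by apply: cube0; exact: mulr_ge0.
  rewrite (cube1 _ _ _ zr) /F2 normrM -mulrA.
  exact: (ler_pM (normr_ge0 _) (normr_ge0 _) (hG z) (hN2 z zr w)).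
have [_ _ _ _ F1E] := lebesgue_fubini mF1 (icube _ _) (icube _ _) F1le.
have iV z : lebesgue_integrable setT (fun x => V x * phi x * eta (z - x)).
  exact: mollify_integrable mV hN.
have [_ _ iF2 iF2' F2E] := lebesgue_fubini mF2 (icube _ _) iK F2le.
(* exchange [x] and [z], insert the mollified equation at [z], exchange [z]
   and [w] *)
have step1 : \int[mu]_x (V x * phi x * average x) =
    2^-1 * \int[mu]_w \int[mu]_z F2 z w.
  rewrite -F2E -(lebesgue_integralZ _ iF2).
  transitivity (\int[mu]_x \int[mu]_z F1 z x).
    apply: lebesgue_integral_ext => x.
    rewrite -(lebesgue_integralZ _ (average_integrand x)).
    by apply: lebesgue_integral_ext => z; rewrite /F1; ring.
  rewrite -F1E; apply: lebesgue_integral_ext => z.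
  rewrite /F1 (lebesgue_integralZ _ (iV z)) -(mollified_equation weak) /F2.
  have iD : lebesgue_integrable setT (fun w => second_diff mollify z w * K w).
    have [N3 N30 hN3] := mollify_second_diff_kernel_le `|z|.
    apply: (le_lebesgue_integrable _ (lebesgue_integrableZ N3 iK)).
      apply: measurable_funM mK.
      exact: (measurable_second_diff mm (measurable_cst z) measurable_lebesgue_id).
    exact: (hN3 z (lexx _)).
  by rewrite (lebesgue_integralZ _ iD) mulrCA.
have [_ _ _ iF3' F3E] := increment_fubini mK K0 iK K_supp txi xi_supp.
rewrite step1 F3E; apply: ler_wpM2l; first by rewrite invr_ge0 ler0n.
apply: (lebesgue_le_integral iF2' iF3') => w.
have iqm := quotient_second_diff_integrable w.
have -> : \int[mu]_z F2 z w = K w * \int[mu]_z (quotient z * second_diff mollify z w).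
  rewrite -(lebesgue_integralZ _ iqm).
  by apply: lebesgue_integral_ext => z; rewrite /F2; ring.
have -> : \int[mu]_z ((xi z - xi (z + w)) ^+ 2 * K w) =
    K w * \int[mu]_z (xi z - xi (z + w)) ^+ 2.
  rewrite -(lebesgue_integralZ _ (increment_integrable w)).
  by apply: lebesgue_integral_ext => z; rewrite mulrC.
by apply: (ler_wpM2l (K0 w)); exact: quotient_second_diff_le.
Qed.

Lemma average_supp x : rho + r <= `|x| -> average x = 0.
Proof.
move=> xr; rewrite /average (lebesgue_integral_ext (g := fun=> 0)).
  by rewrite /Rintegral integral0.
move=> z; have [zr|zr] := leP rho `|z|.
  by rewrite (quotient_supp zr) mul0r.
by rewrite mollifier_supp ?mulr0//; lra.
Qed.

Let etaB_integrable x : lebesgue_integrable setT (fun z => eta (z - x)).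
Proof. exact: integrable_translate (- x) eta_integrable. Qed.

Let le_integral_mass (h : 'rV[R]_n -> R) x c : lebesgue_integrable setT h ->
  (forall z, `|h z| <= c * eta (z - x)) -> `|\int[mu]_z h z| <= c * mass.
Proof.
move=> ih hc; apply: (le_trans (le_normr_Rintegral measurableT ih)).
rewrite -(mass_translate x) -(lebesgue_integralZ c (etaB_integrable x)).
apply: (lebesgue_le_integral (integrable_norm ih)) => //.
exact: lebesgue_integrableZ (etaB_integrable x).
Qed.

(** The bound depends on [eta] only through [r], so that it is uniform along a
    sequence of shrinking mollifiers. *)
Lemma average_bounded m X : 0 < m -> (forall x, `|x| <= rho + r -> m <= phi x) ->
  (forall x, `|xi x| <= X) -> forall x, `|average x| <= X ^+ 2 / m.
Proof.
move=> m0 hm hX x.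
have -> : X ^+ 2 / m = X ^+ 2 / (m * mass) * mass.
  by rewrite invfM mulrA mulfVK// gt_eqF.
apply: (le_integral_mass (average_integrand x)) => z.
rewrite normrM (ger0_norm (eta_ge0 _)); apply: (ler_wpM2r (eta_ge0 _)).
have X2 : 0 <= X ^+ 2 / (m * mass).
  by apply: divr_ge0; [exact: sqr_ge0|exact: ltW (mulr_gt0 m0 mass_gt0)].
have [zr|zr] := leP rho `|z|; first by rewrite (quotient_supp zr) normr0.
have le y : `|y - z| <= r -> `|y| <= rho + r.
  by move=> yz; have := ler_normD (y - z) z; rewrite subrK; lra.
have [P _ hP] := phi_bounded (rho + r).
have /andP[Pm _] := @mollify_bounds z P m (fun y h => hm _ (le y h))
  (fun y h => hP _ (le y h)).
rewrite /quotient normrM normfV normrX (gtr0_norm (mollify_gt0 z)).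
apply: ler_pM; [exact: sqr_ge0|by rewrite invr_ge0 ltW// mollify_gt0| |].
  by apply: lerXn2r (hX z); rewrite nnegrE ?(le_trans _ (hX z)).
by rewrite lef_pV2 ?posrE ?mollify_gt0// mulr_gt0.
Qed.

(** Both [mollify] and [average] are means over balls of radius [r], so only the
    values of [phi] within [2 * r] and of [xi] within [r] of [x] enter. With
    [t], [b], [m] for [xi z ^+ 2], [mollify z] and [mass], the numerator of
    [phi x * (t / b) - s / m] splits into the oscillations of [xi ^+ 2] and [phi],
    and [d <= 2^-1] bounds [phi x * m] by [2 * b]. *)
Lemma average_close x d : 0 < d -> d <= 2^-1 ->
  (forall y, `|y - x| <= 2 * r -> `|phi y - phi x| <= d * phi x) ->
  (forall y, `|y - x| <= r -> `|xi y ^+ 2 - xi x ^+ 2| <= d) ->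
  `|phi x * average x - xi x ^+ 2| <= 2 * d * (1 + xi x ^+ 2).
Proof.
move=> d0 d12 hphi hxi.
pose s := xi x ^+ 2; have s0 : 0 <= s by exact: sqr_ge0.
have a0 := phi_gt0 x.
pose c := 2 * d * (1 + s) / mass.
have -> : 2 * d * (1 + s) = c * mass by rewrite mulfVK// gt_eqF.
have -> : phi x * average x - s =
    \int[mu]_z (phi x * (quotient z * eta (z - x)) - s / mass * eta (z - x)).
  rewrite (lebesgue_integralB (lebesgue_integrableZ _ (average_integrand x))
    (lebesgue_integrableZ _ (etaB_integrable x))).
  rewrite (lebesgue_integralZ _ (average_integrand x)).
  rewrite (lebesgue_integralZ _ (etaB_integrable x)) mass_translate.
  by rewrite mulfVK// gt_eqF.
apply: (@le_integral_mass _ x) => [|z].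
  apply: lebesgue_integrableB; apply: lebesgue_integrableZ.
    exact: average_integrand.
  exact: etaB_integrable.
rewrite mulrA -mulrBl normrM (ger0_norm (eta_ge0 _)).
have [zx|/ltW zx] := leP `|z - x| r; last by rewrite (eta_supp zx) !mulr0.
apply: (ler_wpM2r (eta_ge0 _)).
have near y : `|y - z| <= r -> `|phi y - phi x| <= d * phi x.
  by move=> yz; apply: hphi; have := ler_distD z y x; lra.
have lo y : `|y - z| <= r -> (1 - d) * phi x <= phi y.
  by move=> /near; rewrite ler_norml => /andP[]; lra.
have up y : `|y - z| <= r -> phi y <= (1 + d) * phi x.
  by move=> /near; rewrite ler_norml => /andP[]; lra.
have /andP[] := mollify_bounds lo up.
rewrite /quotient /c; have := hxi z zx; rewrite -/s.
move: (xi z ^+ 2) (mollify z) (mollify_gt0 z) mass mass_gt0 => t b b0 m m0 ts lb ub.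
have -> : phi x * (t / b) - s / m = (phi x * m * (t - s) + s * (phi x * m - b)) / (b * m).
  by field; rewrite !gt_eqF.
rewrite normrM normfV (gtr0_norm (mulr_gt0 b0 m0)) invfM mulrA.
apply: ler_wpM2r; first by rewrite invr_ge0 ltW.
rewrite ler_pdivrMr//.
have am0 : 0 < phi x * m by exact: mulr_gt0.
have h1 : `|phi x * m * (t - s)| <= phi x * m * d.
  by rewrite normrM (gtr0_norm am0) ler_pM2l.
have h2 : `|s * (phi x * m - b)| <= s * (d * (phi x * m)).
  rewrite normrM (ger0_norm s0); apply: (ler_wpM2l s0).
  by rewrite ler_norml; apply/andP; split; lra.
have h3 : phi x * m <= 2 * b.
  have : d * (phi x * m) <= 2^-1 * (phi x * m) by rewrite ler_pM2r.
  by lra.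
apply: (le_trans (ler_normD _ _)); apply: (le_trans (lerD h1 h2)).
have -> : phi x * m * d + s * (d * (phi x * m)) = d * (1 + s) * (phi x * m) by ring.
have -> : 2 * d * (1 + s) * b = d * (1 + s) * (2 * b) by ring.
by apply: ler_wpM2l h3; apply: mulr_ge0; [exact: ltW|exact: addr_ge0].
Qed.

Lemma average_integrable : lebesgue_integrable setT average.
Proof.
have [G G0 hG] := quotient_bounded.
have [E E0 hE] := test_function_iter_bounded [::] teta.
pose F z x := quotient z * eta (z - x).
have mF : measurable_fun setT
    (fun p : lebesgue_rV R n * lebesgue_rV R n => F p.1 p.2).
  apply: measurable_funM.
    exact: (measurableT_comp measurable_quotient measurable_fst_rV).
  exact: (measurableT_comp meta (measurable_rVB measurable_fst_rV measurable_snd_rV)).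
have c0 M t (x : 'rV[R]_n) : 0 <= M -> 0 <= M * \1_[set x : 'rV[R]_n | `|x| <= t] x.
  by move=> M0; rewrite mulr_ge0// indicE ler0n.
have Fle z x : `|F z x| <= (G * \1_[set x : 'rV[R]_n | `|x| <= rho] z) *
    (E * \1_[set x : 'rV[R]_n | `|x| <= rho + r] x).
  have [zr|zr] := leP rho `|z|.
    by rewrite /F (quotient_supp zr) mul0r normr0 mulr_ge0 ?c0.
  have [xr|xr] := leP `|x| (rho + r); last first.
    by rewrite /F mollifier_supp ?mulr0 ?normr0 ?mulr_ge0 ?c0//; lra.
  rewrite !indicE !mem_set//=; last exact: ltW.
  by rewrite !mulr1 normrM; exact: (ler_pM _ _ (hG z) (hE (z - x))).
by have [] := lebesgue_fubini mF (@integrableZ_cube R n G rho)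
  (@integrableZ_cube R n E (rho + r)) Fle.
Qed.

End energy.

End mollified_equation.

End mollification.

(** * Passage to the limit *)

Section stability.
Context {R : realType} {n : nat}.
Implicit Types (x y z w p : 'rV[R]_n).
Local Notation mu := (@lebesgue_vol R n).

Lemma integral_continuous_gt0 (g : 'rV[R]_n -> R) p : continuous g ->
  (forall x, 0 <= g x) -> lebesgue_integrable setT g -> 0 < g p ->
  0 < \int[mu]_x g x.
Proof.
move=> cg g0 ig gp.
have [e e0 he] : exists2 e : R, 0 < e & forall y, `|y| <= e -> g p / 2 <= g (y + p).
  have /cvgrPdist_lt /(_ (g p / 2)) := cg p.
  rewrite divr_gt0// => /(_ isT) /nbhs_ballP[e /= e0 he].
  exists (e / 2) => [|y ye]; first by rewrite divr_gt0.
  have := he (y + p); rewrite -ball_normE /= opprD addrCA subrr addr0 normrN.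
  rewrite (le_lt_trans ye) ?gtr_pMr ?invf_lt1 ?ltr1n// ltr_norml.
  by move=> /(_ isT) /andP[]; lra.
rewrite -(Rintegral_translate p (integrable_measurable ig)).
apply: (@lt_le_trans _ _ (g p / 2 * (2 * e) ^+ n)).
  by rewrite mulr_gt0 ?divr_gt0// exprn_gt0// mulr_gt0.
have -> : (2 * e) ^+ n = \int[mu]_x \1_[set x : 'rV[R]_n | `|x| <= e] x.
  rewrite /Rintegral integral_indic//; last exact: measurable_cube.
  rewrite setIT -[LHS]/(fine ((2 * e) ^+ n)%:E); congr fine.
  exact/esym/lebesgue_vol_cube/ltW.
rewrite -(lebesgue_integralZ _ (integrable_cube_indic e)).
apply: lebesgue_le_integral.
- exact: lebesgue_integrableZ (integrable_cube_indic e).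
- exact: integrable_translate ig.
- move=> x; rewrite indicE; have [xe|xe] := leP `|x| e.
    by rewrite mem_set// mulr1; exact: he.
  by rewrite memNset ?mulr0//= => /(lt_le_trans xe); rewrite ltxx.
Qed.

Variables (K V phi : 'rV[R]_n -> R) (R0 N : R).
Hypotheses (mK : lebesgue_measurable K) (K0 : forall z, 0 <= K z)
  (Keven : {ae mu, forall z, K z = K (- z)})
  (iK : lebesgue_integrable setT (fun w => enorm w ^+ 2 * K w))
  (K_supp : forall w, R0 <= enorm w -> K w = 0)
  (mV : lebesgue_measurable V) (VN : forall x, `|V x| <= N)
  (cphi : continuous phi) (phi_gt0 : forall x, 0 < phi x)
  (weak : weak_solution K V phi).

(** A point where [xi] does not vanish is needed for the mollifiers built from [xi]
    to have positive mass. *)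
Lemma stability_nontrivial (xi : 'rV[R]_n -> R) p : test_function xi -> xi p != 0 ->
  \int[mu]_x (V x * xi x ^+ 2) <=
  2^-1 * \int[mu]_z \int[mu]_w ((xi z - xi (z + w)) ^+ 2 * K w).
Proof.
move=> txi xip.
have cxi : continuous xi := smooth_continuous txi.1.
have /test_functionP[sxi [rho rho0 xi_supp]] := txi.
pose eta k x := xi (k.+1%:R *: x + 0) * xi (k.+1%:R *: x + 0).
pose r k : R := rho / k.+1%:R.
have k0 k : 0 < k.+1%:R :> R by [].
have r0 k : 0 < r k by rewrite divr_gt0.
have rrho k : r k <= rho by rewrite ler_pdivrMr// ler_peMr ?ler1n ?(ltW rho0).
  have eta_ge0 k x : 0 <= eta k x by exact: (sqr_ge0 (xi (k.+1%:R *: x + 0))).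
have eta_supp k x : r k <= `|x| -> eta k x = 0.
  rewrite ler_pdivrMr// => xk; rewrite /eta xi_supp ?mul0r// addr0 normrZ.
  by rewrite ger0_norm// mulrC.
have teta k : test_function (eta k).
  apply/test_functionP; split; last by exists (r k) => //; exact: eta_supp.
  by apply: smoothM; exact: smooth_affine.
have mass_gt0 k : 0 < mass (eta k).
  apply: (@integral_continuous_gt0 _ (k.+1%:R^-1 *: p)) => //.
  - exact: smooth_continuous (teta k).1.
  - exact: eta_integrable (teta k) (eta_supp k).
  - rewrite /eta addr0 scalerA divff ?scale1r ?gt_eqF// -expr2.
    by rewrite lt_neqAle sqr_ge0 eq_sym sqrf_eq0 xip.
pose A k := average phi (eta k) xi.
have energy k : \int[mu]_x (V x * phi x * A k x) <=
    2^-1 * \int[mu]_z \int[mu]_w ((xi z - xi (z + w)) ^+ 2 * K w).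
  exact: (energy_le cphi phi_gt0 (teta k) (eta_ge0 k) (r0 k) (eta_supp k)
    mK K0 Keven iK K_supp txi xi_supp (mass_gt0 k) mV VN weak).
have [m m0 hm] := phi_bounded_below cphi phi_gt0 (rho + rho).
have [P P0 hP] := phi_bounded cphi (rho + rho).
have [X X0 hX] := test_function_iter_bounded [::] txi.
have N0 : 0 <= N by exact: le_trans (normr_ge0 _) (VN 0).
pose B := N * P * (X ^+ 2 / m).
have Acvg x : V x * phi x * A k x @[k --> \oo] --> V x * xi x ^+ 2.
  apply/cvgrPdist_le => eps eps0.
  pose s := xi x ^+ 2; have s0 : 0 <= s by exact: sqr_ge0.
  (* [2 * d * (1 + s)] is the bound of [average_close], and [N + 1] absorbs
     the potential. *)
  pose c := 2 * (1 + s) * (N + 1).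
  have c0 : 0 < c by rewrite /c; apply: mulr_gt0; [apply: mulr_gt0 => //; lra|lra].
  pose d := Num.min (2^-1) (eps / c).
  have d0 : 0 < d by rewrite lt_min invr_gt0 ltr0n divr_gt0.
  have d12 : d <= 2^-1 by rewrite ge_min lexx.
  have dc : d * c <= eps by rewrite -ler_pdivlMr// ge_min lexx orbT.
  have cxi2 : (fun y => xi y ^+ 2) y @[y --> x] --> s.
    have -> : (fun y => xi y ^+ 2) = xi \* xi by apply/funext => y; rewrite expr2.
    by rewrite /s expr2; exact: (cvgM (cxi x) (cxi x)).
  have /nbhs_ballP[t /= t0 ht] : nbhs x [set y |
      `|phi y - phi x| <= d * phi x /\ `|xi y ^+ 2 - s| <= d].
    apply: filterI.
    - have : phi y @[y --> x] --> phi x by exact: cphi.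
      move=> /cvgrPdist_le /(_ _ (mulr_gt0 d0 (phi_gt0 x))).
      by apply: filterS => y; rewrite distrC.
    - by move/cvgrPdist_le : cxi2 => /(_ d d0); apply: filterS => y; rewrite distrC.
  have := near_infty_natSinv_lt (PosNum (divr_gt0 t0 (mulr_gt0 (ltr0n R 2) rho0))).
  apply: filterS => k /= kt.
  have rt : 2 * r k < t.
    rewrite /r mulrA -ltr_pdivlMl ?mulr_gt0//.
    by rewrite mulrC.
  have close y : `|y - x| <= 2 * r k -> ball x t y.
    by move=> yx; rewrite -ball_normE /= distrC (le_lt_trans yx).
  have := average_close cphi phi_gt0 (teta k) (eta_ge0 k) (eta_supp k) txi xi_supp
    (mass_gt0 k) d0 d12 (fun y yx => (ht y (close y yx)).1).
  have h2 y : `|y - x| <= r k -> `|xi y ^+ 2 - xi x ^+ 2| <= d.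
    by move=> yx; have [] := ht y (close y _) => //; have := r0 k; lra.
  move=> /(_ h2) est.
  rewrite -mulrA -mulrBr normrM distrC (le_trans _ dc)//.
  have -> : d * c = (N + 1) * (2 * d * (1 + s)) by rewrite /c; ring.
  by apply: ler_pM; rewrite ?normr_ge0 ?est// (le_trans (VN x))// lerDl.
have cvgI : \int[mu]_x (V x * phi x * A k x) @[k --> \oo] -->
    \int[mu]_x (V x * xi x ^+ 2).
  apply: (Rintegral_dominated_cvg _ _ Acvg (@integrableZ_cube R n B (rho + rho))).
  - move=> k; apply: measurable_funM; last first.
      exact: integrable_measurable (average_integrable cphi phi_gt0 (teta k)
        (eta_ge0 k) (eta_supp k) txi xi_supp (mass_gt0 k)).
    exact: measurable_funM mV (continuous_lebesgue_measurable cphi).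
  - apply: measurable_funM mV _; apply: measurable_funX.
    exact: continuous_lebesgue_measurable cxi.
  - move=> k; apply: le_cube_indic => x xr.
      have Ab : `|A k x| <= X ^+ 2 / m.
        apply: (average_bounded cphi phi_gt0 (teta k) (eta_ge0 k) (eta_supp k)
          txi xi_supp (mass_gt0 k) m0 _ hX) => y yr.
        by apply: hm; have := rrho k; lra.
      rewrite normrM; apply: ler_pM => //.
      by rewrite normrM; apply: ler_pM => //; rewrite gtr0_norm// hP.
    rewrite /A (average_supp phi (eta_supp k) xi_supp) ?mulr0//.
    by have := rrho k; lra.
rewrite -(cvg_lim (@Rhausdorff R) cvgI); apply: limr_le; first exact: cvgP cvgI.
exact: nearW.
Qed.

End stability.

(** For [xi] equal to zero the quadratic form is nonnegative and the potential term
    vanishes. *)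
Lemma stability (R : realType) (n : nat) (K V phi xi : 'rV[R]_n -> R) (R0 N : R) :
  lebesgue_measurable K -> (forall z, 0 <= K z) ->
  {ae @lebesgue_vol R n, forall z, K z = K (- z)} ->
  lebesgue_integrable setT (fun w => enorm w ^+ 2 * K w) ->
  (forall w, R0 <= enorm w -> K w = 0) ->
  lebesgue_measurable V -> (forall x, `|V x| <= N) ->
  continuous phi -> (forall x, 0 < phi x) -> weak_solution K V phi ->
  test_function xi ->
  \int[@lebesgue_vol R n]_x (V x * xi x ^+ 2) <=
  2^-1 * \int[@lebesgue_vol R n]_z \int[@lebesgue_vol R n]_w
    ((xi z - xi (z + w)) ^+ 2 * K w).
Proof.
move=> mK K0 Keven iK K_supp mV VN cphi phi_gt0 weak txi.
have [[p xip]|xi0] := pselect (exists p, xi p != 0).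
  exact: (stability_nontrivial mK K0 Keven iK K_supp mV VN cphi phi_gt0 weak txi xip).
have {}xi0 x : xi x = 0.
  by apply/eqP; apply: contrapT => /negP xix; apply: xi0; exists x.
rewrite (lebesgue_integral_ext (g := fun=> 0)); last first.
  by move=> x; rewrite xi0 expr0n mulr0.
rewrite {1}/Rintegral integral0; apply: mulr_ge0; first by rewrite invr_ge0 ler0n.
apply: Rintegral_ge0 => z _; apply: Rintegral_ge0 => w _.
by rewrite mulr_ge0 ?sqr_ge0.
Qed.

Lemma measurable_bounded_linearization (R : realType) (n : nat) (f : R -> R)
    (u : 'rV[R]_n -> R) : continuous (derive1 f) -> lebesgue_measurable u ->
  (exists M, forall x, `|u x| <= M) ->
  lebesgue_measurable (fun x => derive1 f (u x)) /\
  exists N, forall x, `|derive1 f (u x)| <= N.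
Proof.
move=> cf mu [M uM]; split.
  exact: (measurableT_comp (continuous_measurable_fun cf) mu).
have /compact_bounded[N [_ hN]] : compact (derive1 f @` `[- M, M]%classic).
  by apply: continuous_compact; [exact: continuous_subspaceT|exact: segment_compact].
exists (`|N| + 1) => x; apply: hN.
  by rewrite (le_lt_trans (ler_norm _))// ltrDl.
by exists (u x) => //=; rewrite in_itv/= -ler_norml.
Qed.

Lemma kernel_second_moment (R : realType) (n : nat) (K : 'rV[R]_n -> R) (R0 : R) :
  lebesgue_measurable K -> (forall z, 0 <= K z) ->
  (forall z, ~ eball 0 R0 z -> K z = 0) ->
  (\int[@lebesgue_vol R n]_(z in eball 0 R0) (enorm z ^+ 2 * K z)%:E < +oo)%E ->
  lebesgue_integrable setT (fun w => enorm w ^+ 2 * K w).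
Proof.
move=> mK K0 K_supp Koo; apply/integrableP; split.
  apply/measurable_EFinP/(measurable_funM _ mK)/measurable_funX.
  exact: measurable_enorm.
apply: le_lt_trans Koo; rewrite [leRHS]integral_mkcond le_eqVlt.
apply/orP; left; apply/eqP/eq_integral => z _.
rewrite patchE /= ger0_norm; last by rewrite mulr_ge0 ?sqr_ge0.
case: ifPn => // /negP; rewrite in_setE => /K_supp ->.
by rewrite mulr0.
Qed.

Theorem proposition3p2 (R : realType) (n : nat) (K : 'rV[R]_n -> R)
  (m0 r0 R0 : R) (f : R -> R) (u : 'rV[R]_n -> R) :
  (1 <= n)%N ->
  lebesgue_measurable K ->
  (forall z, 0 <= K z) ->
  {ae @lebesgue_vol R n, forall z, K z = K (- z)} ->
  0 < m0 -> 0 < r0 -> 0 < R0 ->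
  (forall z, m0 * \1_(eball 0 r0) z <= K z) ->
  (forall z, ~ eball 0 R0 z -> K z = 0) ->
  (\int[@lebesgue_vol R n]_(z in eball 0 R0) (enorm z ^+ 2 * K z)%:E < +oo)%E ->
  (forall t, derivable f t 1) -> continuous (derive1 f) ->
  (exists M, forall x, `|u x| <= M) ->
  solution K f u ->
  (exists phi : 'rV[R]_n -> R,
    [/\ continuous phi, forall x, 0 < phi x &
        weak_solution K (fun x => derive1 f (u x)) phi]) ->
  forall xi : 'rV[R]_n -> R, test_function xi ->
    (2^-1%:E * \int[@lebesgue_vol R n]_x \int[@lebesgue_vol R n]_y
       ((xi x - xi (x + y)) ^+ 2 * K y)%:E
     >= \int[@lebesgue_vol R n]_x (derive1 f (u x) * xi x ^+ 2)%:E)%E.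
Proof.
move=> _ mK K0 Keven _ _ _ _ K_out Koo _ cf' bu [mu _] [phi [cphi phi_gt0 weak]].
move=> xi txi.
have iK := kernel_second_moment mK K0 K_out Koo.
have K_supp w : R0 <= enorm w -> K w = 0.
  by move=> wR; apply: K_out; rewrite /eball /= subr0; apply/negP; rewrite -leNgt.
have [mV [N VN]] := measurable_bounded_linearization cf' mu bu.
have := stability mK K0 Keven iK K_supp mV VN cphi phi_gt0 weak txi.
have /test_functionP[sxi [rho rho0 xi_supp]] := txi.
have [iw _ iz _ _] := increment_fubini mK K0 iK K_supp txi xi_supp.
have [X X0 hX] := test_function_iter_bounded [::] txi.
have iV : lebesgue_integrable setT (fun x => derive1 f (u x) * xi x ^+ 2).
  apply: (@integrable_bounded_support _ _ _ (N * X ^+ 2) rho).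
  - apply: measurable_funM mV _; apply: measurable_funX.
    exact: continuous_lebesgue_measurable (smooth_continuous sxi).
  - move=> x _; rewrite normrM normrX; apply: ler_pM => //.
    by apply: lerXn2r (hX x); rewrite nnegrE.
  - by move=> x /ltW /xi_supp ->; rewrite expr0n mulr0.
rewrite -lee_fin EFinM /Rintegral fineK; last exact: integrable_fin_num iV.
have E z : (\int[@lebesgue_vol R n]_w ((xi z - xi (z + w)) ^+ 2 * K w)%:E)%E =
    (\int[@lebesgue_vol R n]_w ((xi z - xi (z + w)) ^+ 2 * K w))%:E.
  by rewrite fineK//; exact: integrable_fin_num (iw z).
rewrite fineK; last exact: integrable_fin_num iz.
move=> le; apply: (le_trans le); rewrite le_eqVlt; apply/orP; left; apply/eqP.
by congr (_ * _)%E; apply: eq_integral => z _; exact/esym/E.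
Qed.
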